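(* Let $N \in \mathbb{N}$, let $f: \mathbb{R}^N \times \mathbb{R}^N \to \mathbb{R}^N$ be a $C^2$-function and let $\tau > 0$. Consider the delay differential equation (DDE) \[ \dot{x}(t) = f(x(t), x(t-\tau)). \] Assume that 1. the DDE has a periodic solution $x_\ast: \mathbb{R} \to \mathbb{R}^N$ with minimal period $p > 0$; 2. the DDE is equivariant with respect to a compact subgroup $\Gamma$ of $\mathrm{GL}(N, \mathbb{R})$, i.e. $f(\gamma x, \gamma y) = \gamma f(x, y)$ for all $x, y \in \mathbb{R}^N$ and all $\gamma \in \Gamma$; 3. the periodic solution $x_\ast$ is a discrete wave and there exists a spatio-temporal symmetry $h \in H_\ast$ whose time shift $\Theta(h)p$ equals the delay $\tau$, so that \[ h x_\ast(t) = x_\ast(t+\tau) \qquad \text{for all } t \in \mathbb{R}. \] Let $U(t,s)$, $t \geq s$, be the family of solution operators of the linearized DDE \[ \dot{y}(t) = \partial_1 f(x_\ast(t), x_\ast(t-\tau))\, y(t) + \partial_2 f(x_\ast(t), x_\ast(t-\tau))\, y(t-\tau). \] For $z \in \mathbb{C}$, let $F(t,z) \in \mathbb{C}^{N \times N}$ be the fundamental solution of the ODE \[ \dot{y}(t) = \left[\partial_1 f(x_\ast(t), x_\ast(t-\tau)) + z \cdot \partial_2 f(x_\ast(t), x_\ast(t-\tau))\, h^{-1}\right] y(t) \] with $F(0,z) = I_{\mathbb{C}^N}$. Then the analytic function \[ \Delta(z) = I_{\mathbb{C}^N} - z h^{-1} F(\Theta(h)p, z) \] is a characteristic matrix function for the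 operator \[ U_h = h^{-1} U(\Theta(h)p, 0). \]
   Context: Symmetry groups. For a periodic solution $x_\ast$ with minimal period $p>0$ of a $\Gamma$-equivariant DDE, define \[ K_\ast = \{\gamma \in \Gamma \mid \gamma x_\ast(t) = x_\ast(t) \text{ for all } t \in \mathbb{R}\}, \] \[ H_\ast = \{\gamma \in \Gamma \mid \text{there exists } \Theta(\gamma) \in [0,1) \text{ such that } \gamma x_\ast(t) = x_\ast(t+\Theta(\gamma)p) \text{ for all } t \in \mathbb{R}\}. \] Elements of $H_\ast$ are called spatio-temporal symmetries of $x_\ast$; $\Theta(\gamma) \in [0,1)$ is uniquely determined by $\gamma \in H_\ast$. The map $\Theta: H_\ast \to \mathbb{R}/\mathbb{Z}$ is a group homomorphism with kernel $K_\ast$, so $K_\ast$ is normal in $H_\ast$. The periodic solution $x_\ast$ is called a discrete wave if $H_\ast/K_\ast \simeq \mathbb{Z}_m$ for some $m \in \mathbb{N}$, i.e. if $H_\ast/K_\ast$ is a finite (cyclic) group. Solution operators. $\partial_1 f$, $\partial_2 f$ denote the derivatives of $f$ with respect to its first and second argument. For a linear DDE $\dot y(t) = A(t)y(t)+B(t)y(t-\tau)$, $t \ge s$, with initial condition $y(s+\theta)=\varphi(\theta)$ for $\theta \in [-\tau,0]$, $\varphi \in C([-\tau,0],\mathbb{R}^N)$, let $y(t)$ be the unique solution for $t\ge s$ and define the history segment $y_t \in C([-\tau,0],\mathbb{R}^N)$ by $y_t(\theta) = y(t+\theta)$. The family of solution operators $U(t,s): C([-\tau,0],\mathbb{R}^N)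 \to C([-\tau,0],\mathbb{R}^N)$, $t \ge s$, is defined by $U(t,s)\varphi = y_t$. A matrix $\gamma \in \mathrm{GL}(N,\mathbb{R})$ acts on $C([-\tau,0],\mathbb{R}^N)$ by $(\gamma\varphi)(\theta) = \gamma\,\varphi(\theta)$. The operator $U_h$ is identified with its complexification, a bounded linear operator on the complex Banach space $C([-\tau,0],\mathbb{C}^N)$ (supremum norm). Characteristic matrix function. Let $X$ be a complex Banach space, $T: X\to X$ a bounded linear operator and $\Delta: \mathbb{C} \to \mathbb{C}^{n\times n}$ an analytic matrix-valued function. $\Delta$ is called a characteristic matrix function for $T$ if there exist analytic functions $\mathcal{E}, \mathcal{F}: \mathbb{C} \to \mathcal{L}(\mathbb{C}^n \oplus X, \mathbb{C}^n\oplus X)$ (bounded linear operators) such that $\mathcal{E}(z), \mathcal{F}(z)$ are invertible operators for all $z \in \mathbb{C}$ and \[ \begin{pmatrix} \Delta(z) & 0 \\ 0 & I_X \end{pmatrix} = \mathcal{F}(z) \begin{pmatrix} I_{\mathbb{C}^n} & 0 \\ 0 & I_X - zT \end{pmatrix} \mathcal{E}(z) \qquad \text{for all } z \in \mathbb{C}. \] *)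

(* Defs.v *)
From HB Require Import structures.
From mathcomp Require Import all_boot all_order all_algebra.
From mathcomp Require Import all_classical all_reals all_analysis.
From mathcomp Require Import complex ring.
Set Implicit Arguments.
Unset Strict Implicit.
Unset Printing Implicit Defensive.
Import Order.TTheory GRing.Theory Num.Theory.
Import numFieldNormedType.Exports.
Local Open Scope classical_set_scope.
Local Open Scope complex_scope.
Local Open Scope ring_scope.

HB.instance Definition _ (R : realType) := NormedModule.copy R[i] R[i]^o.

Section complex_complete.
Variable R : realType.
Local Notation Re := (@complex.Re R).
Local Notation Im := (@complex.Im R).

Lemma normc_ReIm (x : R[i]) : `|x| <= (`|Re x| + `|Im x|)%:C.
Proof.
have nC (a : R) : `|a%:C| = `|a|%:C by rewrite normc_def /= expr0n /= addr0 sqrtr_sqr.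
have n1 : `|'i%C : R[i]| = 1 by rewrite normc_def /= expr0n /= add0r expr1n sqrtr1.
rewrite [in leLHS](complexE x) (le_trans (ler_normD _ _))//.
by rewrite normrM n1 mul1r !nC -rmorphD.
Qed.

Lemma normc_leR (x : R[i]) : (`|Re x|%:C <= `|x|) * (`|Im x|%:C <= `|x|).
Proof.
split; rewrite normc_def lecR -sqrtr_sqr ler_wsqrtr//; first by rewrite lerDl sqr_ge0.
by rewrite lerDr sqr_ge0.
Qed.

Lemma posc (e : R[i]) : 0 < e -> 0 < Re e /\ e = (Re e)%:C.
Proof. by rewrite ltcE /= => /andP[/eqP]; case: e => a b /= -> ->. Qed.

Lemma complex_complete (F : set_system R[i]) :
  ProperFilter F -> cauchy F -> cvg F.
Proof.
move=> FF /cauchyP Fc.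
have Rc : cvg (Re @ F).
  apply: cauchy_cvg; apply: cauchy_exP => e e0.
  have [x Fx] := Fc e%:C (ltac:(by rewrite ltcR)).
  exists (Re x); rewrite /nbhs /=; apply: (@filterS _ F _ (ball x e%:C)) => // y.
  rewrite /= -!ball_normE /= -ltcR; apply: le_lt_trans.
  by have := (normc_leR (x - y)).1; case: (x) (y) => [? ?][].
have Ic : cvg (Im @ F).
  apply: cauchy_cvg; apply: cauchy_exP => e e0.
  have [x Fx] := Fc e%:C (ltac:(by rewrite ltcR)).
  exists (Im x); rewrite /nbhs /=; apply: (@filterS _ F _ (ball x e%:C)) => // y.
  rewrite /= -!ball_normE /= -ltcR; apply: le_lt_trans.
  by have := (normc_leR (x - y)).2; case: (x) (y) => [? ?][].
apply/cvg_ex; exists ((lim (Re @ F)) +i* (lim (Im @ F))).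
apply/(@cvgrPdist_lt _ (R[i])) => e /posc[e0 ->].
have /cvgrPdist_lt hr := Rc; have /cvgrPdist_lt hi := Ic.
near=> z; rewrite (le_lt_trans (normc_ReIm _))// ltcR (splitr (Re e)) ltrD//.
  rewrite [Re _](_ : _ = lim (Re @ F) - Re z); last by case: (z).
  by near: z; apply: hr; rewrite divr_gt0.
rewrite [Im _](_ : _ = lim (Im @ F) - Im z); last by case: (z).
by near: z; apply: hi; rewrite divr_gt0.
Unshelve. all: by end_near. Qed.

End complex_complete.

HB.instance Definition _ (R : realType) :=
  Uniform_isComplete.Build R[i] (@complex_complete R).

HB.instance Definition _ (R : realType) m n := Complete.on 'M[R[i]]_(m, n).

(* The space C(T, V) of continuous functions, with its own name so that the
   topology put on it below is the one of the supremum norm. *)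
Section cspace.
Context {K : numFieldType} {T : topologicalType} {V : normedModType K}.

Definition cspace (T : topologicalType) (V : normedModType K) := continuousType T V.
HB.instance Definition _ := Choice.on (cspace T V).

Implicit Types f g : cspace T V.

Let cadd_cts f g : continuous (fun t => f t + g t).
Proof. by move=> t; apply: cvgD; exact: cts_fun. Qed.
Let copp_cts f : continuous (fun t => - f t).
Proof. by move=> t; apply: cvgN; exact: cts_fun. Qed.
Let cscale_cts (c : K) f : continuous (fun t => c *: f t).
Proof. by move=> t; apply: cvgZl_tmp; exact: cts_fun. Qed.

Definition cadd f g : cspace T V := mkcts (@cadd_cts f g).
Definition copp f : cspace T V := mkcts (@copp_cts f).
Definition czero : cspace T V := cst 0.
Definition cscale (c : K) f : cspace T V := mkcts (@cscale_cts c f).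

Let caddA : associative cadd.
Proof. by move=> f g h; apply/continuousEP => t; exact: addrA. Qed.
Let caddC : commutative cadd.
Proof. by move=> f g; apply/continuousEP => t; exact: addrC. Qed.
Let cadd0 : left_id czero cadd.
Proof. by move=> f; apply/continuousEP => t; exact: add0r. Qed.
Let caddN : left_inverse czero copp cadd.
Proof. by move=> f; apply/continuousEP => t; exact: addNr. Qed.

HB.instance Definition _ := GRing.isZmodule.Build (cspace T V) caddA caddC cadd0 caddN.

Let cscaleA a b f : cscale a (cscale b f) = cscale (a * b) f.
Proof. by apply/continuousEP => t; exact: scalerA. Qed.
Let cscale1 : left_id 1 cscale.
Proof. by move=> f; apply/continuousEP => t; exact: scale1r. Qed.
Let cscaleDr : right_distributive cscale +%R.
Proof. by move=> c f g; apply/continuousEP => t; exact: scalerDr. Qed.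
Let cscaleDl f : {morph cscale^~ f : a b / a + b}.
Proof. by move=> a b; apply/continuousEP => t; exact: scalerDl. Qed.

HB.instance Definition _ := GRing.Zmodule_isLmodule.Build K (cspace T V)
  cscaleA cscale1 cscaleDr cscaleDl.

End cspace.

Lemma complexRe_continuous (R : realType) : continuous (@complex.Re R).
Proof.
move=> x; apply/(@cvgrPdist_lt _ _ _ (nbhs x)) => e e0; near=> y.
rewrite -ltcR (@le_lt_trans _ _ `|x - y|)//.
  by have := (normc_leR (x - y)).1; case: (x) (y) => [? ?][].
by near: y; apply: cvgr_dist_lt; rewrite ?ltcR.
Unshelve. all: by end_near. Qed.

Lemma complexIm_continuous (R : realType) : continuous (@complex.Im R).
Proof.
move=> x; apply/(@cvgrPdist_lt _ _ _ (nbhs x)) => e e0; near=> y.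
rewrite -ltcR (@le_lt_trans _ _ `|x - y|)//.
  by have := (normc_leR (x - y)).2; case: (x) (y) => [? ?][].
by near: y; apply: cvgr_dist_lt; rewrite ?ltcR.
Unshelve. all: by end_near. Qed.

Lemma real_complex_continuous (R : realType) : continuous (real_complex R).
Proof.
move=> x; apply/cvgrPdist_lt => e /posc[e0 ->]; near=> y.
rewrite -rmorphB normc_def /= expr0n /= addr0 sqrtr_sqr ltcR.
by near: y; apply/nbhs_normP; exists (complex.Re e).
Unshelve. all: by end_near. Qed.

Notation Cseg a b V := (cspace (set_type (`[a, b]%classic)) V).

Section csegment.
Context {R : realType} {a b : R} {V : normedModType R[i]}.
Local Notation Seg := (set_type (`[a, b]%classic : set R)).
Local Notation X := (Cseg a b V).
Implicit Types f g : X.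

(* Norms of complex normed modules take (real) values in R[i], and so must
   the supremum norm; the supremum itself is taken in R. *)
Definition csup f : R[i] := (sup [set complex.Re `|f t| | t in [set: Seg]])%:C.

Let Rnorm (v : V) : `|v| = (complex.Re `|v|)%:C.
Proof. by rewrite RRe_real// normr_real. Qed.

Let ubnd f : exists M : R, forall t, complex.Re `|f t| <= M.
Proof.
pose g (t : Seg) : R := complex.Re `|f t|.
have cg : continuous g.
  move=> t; apply/(@cvgrPdist_lt _ _ _ (nbhs t)) => e e0.
  have e0' : 0 < e%:C by rewrite ltcR.
  have /cvgrPdist_lt/(_ _ e0') := @cts_fun _ _ f t.
  apply: filterS => s fts; rewrite -ltcR; apply: le_lt_trans fts.
  apply: le_trans (ler_dist_dist _ _).
  have := (normc_leR (`|f t| - `|f s|)).1.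
  by rewrite /g; case: (`|f t|) (`|f s|) => [? ?] [].
have /subspace_valL_continuousP cf := cg.
have [M [_ MP]] := compact_bounded (continuous_compact cf (@segment_compact _ a b)).
exists (M + 1) => t; apply: le_trans (ler_norm _) _; apply: (MP (M + 1)); first by rewrite ltrDl.
exists (\val t); first exact: set_valP.
exact: (congr1 (fun k => k t) (valLK point g)).
Qed.

Let has_sup_f f (t : Seg) : has_sup [set complex.Re `|f t| | t in [set: Seg]].
Proof.
split; first by exists (complex.Re `|f t|), t.
by have [M MP] := ubnd f; exists M => _ [s _ <-].
Qed.

Lemma csup_ub f t : `|f t| <= csup f.
Proof.
rewrite Rnorm lecR; apply: sup_upper_bound; first exact: has_sup_f.
by exists t.
Qed.

Lemma csup_le f (e : R[i]) : 0 <= e -> (forall t, `|f t| <= e) -> csup f <= e.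
Proof.
move=> e0 fe; have [er eE] : exists er : R, e = er%:C by apply/complex_realP; exact: ger0_real.
subst e; rewrite /csup lecR; have [[t]|/forallNP S0] := pselect (exists t : Seg, True).
  move=> _; apply: ge_sup; first by exists (complex.Re `|f t|), t.
  by move=> _ [s _ <-]; rewrite -lecR -Rnorm.
rewrite (_ : [set _ | _ in _] = set0) ?sup0.
  by rewrite -lecR.
by apply/seteqP; split => // x [t]; have := S0 t.
Qed.

Lemma csup_ge0 f : 0 <= csup f.
Proof.
have [[t _]|/forallNP S0] := pselect (exists t : Seg, True).
  exact: le_trans (csup_ub f t).
by rewrite /csup (_ : [set _ | _ in _] = set0) ?sup0//;
  apply/seteqP; split => // x [t]; have := S0 t.
Qed.

Let csupD f g : csup (f + g) <= csup f + csup g.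
Proof.
apply: csup_le => [|t]; first by rewrite addr_ge0// csup_ge0.
by rewrite (le_trans (ler_normD _ _))// lerD// csup_ub.
Qed.

Let csupZ (l : R[i]) f : csup (l *: f) = `|l| * csup f.
Proof.
apply/le_anti/andP; split.
  apply: csup_le => [|t]; first by rewrite mulr_ge0// csup_ge0.
  by rewrite [leLHS]normrZ ler_wpM2l// csup_ub.
have [->|l0] := eqVneq l 0; first by rewrite normr0 mul0r csup_ge0.
rewrite -ler_pdivlMl ?normr_gt0//; apply: csup_le => [|t].
  by rewrite mulr_ge0 ?csup_ge0// invr_ge0.
by rewrite ler_pdivlMl ?normr_gt0// -normrZ; exact: (csup_ub (l *: f)).
Qed.

Let csup_eq0 f : csup f = 0 -> f = 0.
Proof.
move=> f0; apply/continuousEP => t; apply/eqP; rewrite -normr_le0 -f0.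
exact: csup_ub.
Qed.

HB.instance Definition _ :=
  Lmodule_isNormed.Build R[i] X csupD csupZ csup_eq0.

End csegment.

Section csegment_complete.
Context {R : realType} {a b : R} {V : completeNormedModType R[i]}.
Local Notation Seg := (set_type (`[a, b]%classic : set R)).
Local Notation X := (Cseg a b V).

Let X_complete (F : set_system X) : ProperFilter F -> cauchy F -> cvg F.
Proof.
move=> FF Fc.
have Fd (e : R[i]) : 0 < e -> \forall f \near F, \forall g \near F, `|f - g| <= e.
  move=> e0; apply: nearP_dep.
  have /cauchy_ballP/(_ _ e0) := Fc.
  by apply: filterS => -[f g] /=; rewrite -ball_normE => /ltW.
have ct (t : Seg) : cvg ((fun f : X => f t) @ F).
  apply: cauchy_cvg; apply/cauchyP => e e0.
  have e20 : 0 < e / 2 by rewrite divr_gt0.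
  have [f /= Ff] := filter_ex (Fd _ e20).
  exists (f t); rewrite /nbhs /=; apply: (@filterS _ F _ _ _ _ Ff) => g fg.
  rewrite /= -ball_normE /= (le_lt_trans (csup_ub (f - g) t))//.
  by rewrite (le_lt_trans fg)// ltr_pdivrMr// ltr_pMr// ltr1n.
pose g (t : Seg) := lim ((fun f : X => f t) @ F).
have Fg (e : R[i]) : 0 < e -> F [set f : X | forall t, `|f t - g t| <= e].
  move=> e0; have e20 : 0 < e / 2 by rewrite divr_gt0.
  apply: filterS (Fd _ e20) => f Ff t.
  have /cvgrPdist_le/(_ _ e20) gt := ct t.
  have [h [/= fh hg]] := filter_ex (filterI Ff gt).
  rewrite -(subrKA (h t)) (splitr e) (le_trans (ler_normD _ _))// lerD//.
    exact: le_trans (csup_ub (f - h) t) fh.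
  by rewrite distrC.
have cg : continuous g.
  move=> t; apply/(@cvgrPdist_le _ _ _ (nbhs t)) => e e0.
  have e30 : 0 < e / 3 by rewrite divr_gt0.
  have [f fg] := filter_ex (Fg _ e30).
  have /(@cvgrPdist_le _ _ _ (nbhs t))/(_ _ e30) := @cts_fun _ _ f t.
  apply: filterS => s fts.
  rewrite -(subrKA (f t)) -[f t - _](subrKA (f s)) addrA.
  have -> : e = e / 3 + e / 3 + e / 3.
    by field.
  rewrite (le_trans (ler_normD _ _))// lerD// (le_trans (ler_normD _ _))// lerD//.
  by rewrite distrC.
apply/cvg_ex; exists (mkcts cg : X); apply/cvgrPdist_le => e e0.
apply: filterS (Fg _ e0) => f fg; apply: csup_le => [|t]; first exact: ltW.
by rewrite [leLHS]distrC.
Qed.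

HB.instance Definition _ := Uniform_isComplete.Build X X_complete.

End csegment_complete.

Section bounded_operators.
Context {R : realType}.
Implicit Types V W : normedModType R[i].

(* |L v| <= M * |v| forces M to be real unless V = 0 *)
Definition bounded_linear V W (L : V -> W) : Prop :=
  linear L /\ exists M : R[i], forall v, `|L v| <= M * `|v|.

Definition invertible_op V W (L : V -> W) : Prop :=
  bounded_linear L /\
  exists G : W -> V, [/\ bounded_linear G, cancel L G & cancel G L].

(* u n --> L for the operator norm, i.e. sup_(v != 0) |u n v - L v| / |v| --> 0 *)
Definition op_cvg V W (u : nat -> V -> W) (L : V -> W) : Prop :=
  forall e : R, 0 < e ->
    \forall n \near \oo, forall v, `|u n v - L v| <= e%:C * `|v|.

Definition analytic V (g : R[i] -> V) : Prop :=
  forall z0 : R[i], exists (a : nat -> V) (r : R), 0 < r /\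
    forall z, `|z - z0| < r%:C ->
      series (fun k => (z - z0) ^+ k *: a k) @ \oo --> g z.

(* analyticity of a map into the bounded operators with the operator norm *)
Definition analytic_op V W (E : R[i] -> V -> W) : Prop :=
  forall z0 : R[i], exists (a : nat -> V -> W) (r : R),
    [/\ 0 < r, forall k, bounded_linear (a k) &
      forall z, `|z - z0| < r%:C ->
        op_cvg (fun n v => \sum_(k < n) (z - z0) ^+ k *: a k v) (E z)].

Definition characteristic_matrix_function (X : completeNormedModType R[i])
    (T : X -> X) (n : nat) (Delta : R[i] -> 'M[R[i]]_n) : Prop :=
  [/\ bounded_linear T, analytic Delta &
    exists E F : R[i] -> ('cV[R[i]]_n * X)%type -> ('cV[R[i]]_n * X)%type,
      [/\ analytic_op E, analytic_op F,
          forall z, invertible_op (E z), forall z, invertible_op (F z) &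
          forall z w, (Delta z *m w.1, w.2) =
            F z ((E z w).1, (E z w).2 - z *: T (E z w).2)]].

End bounded_operators.

Lemma mx_continuous (K : numFieldType) (V : pseudoMetricType K)
    (T : topologicalType) m n (g : T -> 'M[V]_(m, n)) :
  (forall i j, continuous (fun t => g t i j)) -> continuous g.
Proof.
move=> cg t; apply/(@cvg_ballP _ _ _ (nbhs t)) => e e0.
have H : \forall s \near t, forall i j, ball (g t i j) e (g s i j).
  apply: filter_forall => i; apply: filter_forall => j.
  by have /(@cvg_ballP _ _ _ (nbhs t))/(_ _ e0) := cg i j t.
by apply: filterS H => s Hs; split.
Qed.

Section operators.
Context {R : realType} {T : topologicalType} {N : nat}.
Local Notation CR := (cspace T 'cV[R]_N).
Local Notation CC := (cspace T 'cV[R[i]]_N).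

Let coordR (phi : CR) i j : continuous (fun t => phi t i j).
Proof.
move=> t; apply: (@continuous_comp _ _ _ phi (fun M : 'cV[R]_N => M i j)).
  exact: cts_fun.
exact: coord_continuous.
Qed.

Let coordC (phi : CC) i j : continuous (fun t => phi t i j).
Proof.
move=> t; apply: (@continuous_comp _ _ _ phi (fun M : 'cV[R[i]]_N => M i j)).
  exact: cts_fun.
exact: (@coord_continuous R[i]).
Qed.

Let cact_cts (g : 'M[R]_N) (phi : CR) : continuous (fun t => g *m phi t).
Proof.
apply: mx_continuous => i j.
have -> : (fun t => (g *m phi t) i j) = (fun t => \sum_k g i k * phi t k j).
  by apply/funext => t; rewrite mxE.
elim: (index_enum _) => [|k r IH].
  under eq_fun do rewrite big_nil.
  by move=> t; exact: cvg_cst.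
under eq_fun do rewrite big_cons.
by move=> t; apply: cvgD; [apply: cvgMl_tmp; exact: coordR|exact: IH].
Qed.

Let cRe_cts (phi : CC) : continuous (fun t => map_mx (@complex.Re R) (phi t)).
Proof.
apply: mx_continuous => i j.
rewrite (_ : (fun t => _) = @complex.Re R \o (fun t => phi t i j)); last first.
  by apply/funext => t; rewrite mxE.
move=> t; apply: continuous_comp; [exact: coordC|exact: complexRe_continuous].
Qed.

Let cIm_cts (phi : CC) : continuous (fun t => map_mx (@complex.Im R) (phi t)).
Proof.
apply: mx_continuous => i j.
rewrite (_ : (fun t => _) = @complex.Im R \o (fun t => phi t i j)); last first.
  by apply/funext => t; rewrite mxE.
move=> t; apply: continuous_comp; [exact: coordC|exact: complexIm_continuous].
Qed.

Let cpair_cts (phi psi : CR) :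
  continuous (fun t => map2_mx (@Complex R) (phi t) (psi t)).
Proof.
apply: mx_continuous => i j.
rewrite (_ : (fun t => _) = fun t => phi t i j +i* psi t i j); last first.
  by apply/funext => t; rewrite mxE.
move=> t; apply/(@cvgrPdist_lt _ _ _ (nbhs t)) => e /posc[e0 ->].
have e20 : 0 < complex.Re e / 2 by rewrite divr_gt0.
have /(@cvgrPdist_lt _ _ _ (nbhs t))/(_ _ e20) h1 := @coordR phi i j t.
have /(@cvgrPdist_lt _ _ _ (nbhs t))/(_ _ e20) h2 := @coordR psi i j t.
apply: filterS (filterI h1 h2) => s [/= h1s h2s].
by rewrite (le_lt_trans (normc_ReIm _))// ltcR (splitr (complex.Re e)) ltrD.
Qed.

Definition cact (g : 'M[R]_N) (phi : CR) : CR := mkcts (@cact_cts g phi).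
Definition cRe (phi : CC) : CR := mkcts (@cRe_cts phi).
Definition cIm (phi : CC) : CR := mkcts (@cIm_cts phi).
Definition cpair (phi psi : CR) : CC := mkcts (@cpair_cts phi psi).

Definition complexification (L : CR -> CR) (phi : CC) : CC :=
  cpair (L (cRe phi)) (L (cIm phi)).

End operators.

Section calculus.
Context {R : realType}.

(* For finite-dimensional V the derivative v |-> 'd f v is C^k iff all the maps
   'D_u f are. *)
Fixpoint Ck (k : nat) (V W : normedModType R) (f : V -> W) : Prop :=
  if k is k'.+1 then
    (forall v, differentiable f v) /\ (forall u, Ck k' ('D_u f))
  else continuous f.

Definition jacobian_cV m n (g : 'cV[R]_n -> 'cV[R]_m) (a : 'cV[R]_n) :
    'M[R]_(m, n) :=
  \matrix_(i, j) ('d g a (delta_mx j 0)) i 0.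

Definition partial1 N (f : 'cV[R]_N * 'cV[R]_N -> 'cV[R]_N)
    (a b : 'cV[R]_N) : 'M[R]_N := jacobian_cV (fun u => f (u, b)) a.

Definition partial2 N (f : 'cV[R]_N * 'cV[R]_N -> 'cV[R]_N)
    (a b : 'cV[R]_N) : 'M[R]_N := jacobian_cV (fun u => f (a, u)) b.

(* derivative of a complex matrix-valued function of a real variable; the
   library's is_derive needs the same scalars on both sides *)
Definition is_Cderive m n (Y : R -> 'M[R[i]]_(m, n)) (t : R)
    (dY : 'M[R[i]]_(m, n)) : Prop :=
  (fun e : R => (e^-1)%:C *: (Y (t + e) - Y t)) @ 0^' --> dY.

End calculus.

Section symmetry.
Context {R : realType} {N : nat}.
Implicit Types (Gamma H K : set 'M[R]_N) (x : R -> 'cV[R]_N) (p : R).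

Definition subgroup_GL Gamma : Prop :=
  [/\ forall g, Gamma g -> g \in unitmx, Gamma 1%:M,
      forall g h, Gamma g -> Gamma h -> Gamma (g *m h) &
      forall g, Gamma g -> Gamma (invmx g)].

Definition equivariant Gamma (f : 'cV[R]_N * 'cV[R]_N -> 'cV[R]_N) : Prop :=
  forall g, Gamma g -> forall a b, f (g *m a, g *m b) = g *m f (a, b).

Definition minimal_period x p : Prop :=
  [/\ 0 < p, forall t, x (t + p) = x t &
      forall q, 0 < q < p -> ~ (forall t, x (t + q) = x t)].

Definition spatial_symmetries Gamma x : set 'M[R]_N :=
  [set g | Gamma g /\ forall t, g *m x t = x t].

Definition phase_shift x p (g : 'M[R]_N) : set R :=
  [set theta | 0 <= theta < 1 /\ forall t, g *m x t = x (t + theta * p)].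

Definition spatiotemporal_symmetries Gamma x p : set 'M[R]_N :=
  [set g | Gamma g /\ exists theta, phase_shift x p g theta].

Definition Theta x p (g : 'M[R]_N) : R := xget 0 (phase_shift x p g).

Definition coset_mx K (g : 'M[R]_N) : set 'M[R]_N := [set g *m k | k in K].

Definition quotient_mx H K : set (set 'M[R]_N) := [set coset_mx K g | g in H].

(* 'I_m.+1 carries the library's additive group Z/(m+1)Z *)
Definition discrete_wave Gamma x p : Prop :=
  let H := spatiotemporal_symmetries Gamma x p in
  let K := spatial_symmetries Gamma x in
  exists (m : nat) (j : set 'M[R]_N -> 'I_m.+1),
    set_bij (quotient_mx H K) [set: 'I_m.+1] j /\
    forall g h, H g -> H h ->
      j (coset_mx K (g *m h)) = j (coset_mx K g) + j (coset_mx K h).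

End symmetry.

Section delay_equations.
Context {R : realType} {N : nat}.

Definition dde_solution (f : 'cV[R]_N * 'cV[R]_N -> 'cV[R]_N) (tau : R)
    (x : R -> 'cV[R]_N) : Prop :=
  forall t : R, is_derive t 1 x (f (x t, x (t - tau))).

(* at t = s the equation involves the right derivative *)
Definition linear_dde_ivp (A B : R -> 'M[R]_N) (tau s : R)
    (phi : Cseg (- tau) 0 'cV[R]_N) (y : R -> 'cV[R]_N) : Prop :=
  [/\ forall theta, y (s + \val theta) = phi theta,
      {within `[s - tau, +oo[, continuous y},
      forall t : R, s < t -> is_derive t 1 y (A t *m y t + B t *m y (t - tau)) &
      (fun e : R => e^-1 *: (y (s + e) - y s)) @ 0^'+ -->
        A s *m y s + B s *m y (s - tau)].

(* the history segment y_t is given by its values y (t + theta) *)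
Definition solution_operators (A B : R -> 'M[R]_N) (tau : R)
    (U : R -> R -> Cseg (- tau) 0 'cV[R]_N -> Cseg (- tau) 0 'cV[R]_N) : Prop :=
  forall s phi, exists y, linear_dde_ivp A B s phi y /\
    forall t, s <= t -> forall theta, U t s phi theta = y (t + \val theta).

Definition fundamental_solution (M : R -> 'M[R[i]]_N) (Y : R -> 'M[R[i]]_N) :
    Prop :=
  Y 0 = 1%:M /\ forall t, is_Cderive Y t (M t *m Y t).

End delay_equations.

(* Main.v *)
(** Write [U_h = V + D C], where [C phi = phi 0], [(D u)(theta) = h^-1 F(tau + theta, 0) u]
    and [V phi = h^-1 v_tau], with [v] the solution of [v' = A v + B phi(. - tau)], [v 0 = 0].
    Gronwall's inequality in a norm with an exponential weight makes [z V] a contraction, so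
    [I - z V] has a bounded inverse [P z] for every [z] (Neumann series), and the resolvent
    identity makes [P] analytic.  By uniqueness of solutions, [P z (D u)] is
    [theta |-> h^-1 F(tau + theta, z) u], whence [Delta z = I - z C (P z) D].  A Schur complement
    then turns [I - z U_h = (I - z V) (I - z (P z) D C)] into [Delta z]. *)

Require Import Defs.
From mathcomp Require Import all_boot all_order all_algebra.
From mathcomp Require Import all_classical all_reals all_analysis.
From mathcomp Require Import complex ring lra.
Import Order.TTheory GRing.Theory Num.Theory.
Import numFieldNormedType.Exports.
Local Open Scope classical_set_scope.
Local Open Scope complex_scope.
Local Open Scope ring_scope.

Set Implicit Arguments.
Unset Strict Implicit.

(** * Bounded operators and analyticity *)

(** The time shift equals the delay. On [[0, tau]] the delayed value is therefore the initial
    function, and the monodromy operator only involves an ODE with known forcing on one delay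
    interval. Conversely, if [phi (t - tau)] is [h^-1 y(t)], the delayed term [B phi (t - tau)]
    turns into [B h^-1 y(t)]; this is how [z B h^-1] enters the coefficient of the ODE for [F].

    In the supremum norm [z V] need not be a contraction, and no single weight serves all [z]: the
    exponent has to grow with [|z|^2]. The space keeps its supremum norm. The weight only appears in
    estimates for the iterates of [z V], and the price of comparing the two norms becomes a constant
    [C] in front of the geometric decay [(1/2)^k]. The Neumann series is therefore stated for
    operators whose iterates decay, not for contractions.

    The ODE estimates concern the squared Euclidean norm on [C^N], which is polynomial in real and
    imaginary parts and hence differentiable along solutions. A contraction factor [1/2] for norms
    thus appears as [(1/2)^2] for energies. *)

Section bounded_operator_theory.
Context {R : realType}.
Implicit Types V W Y Z : normedModType R[i].

Lemma linear_rules V W (L : V -> W) : linear L ->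
  ((forall u v, L (u - v) = L u - L v) * (forall u v, L (u + v) = L u + L v) *
   (forall a u, L (a *: u) = a *: L u) * (L 0 = 0)).
Proof.
move=> lL; have L0 : L 0 = 0 by have := lL (-1) 0 0; rewrite scaler0 addr0 scaleN1r addNr.
have LD u v : L (u + v) = L u + L v by have := lL 1 u v; rewrite !scale1r.
have LZ a u : L (a *: u) = a *: L u by have := lL a u 0; rewrite L0 !addr0.
by do !split=> //; move=> u v; rewrite LD -scaleN1r LZ scaleN1r.
Qed.

Lemma linear_sum V W (L : V -> W) n (F : 'I_n -> V) : linear L ->
  L (\sum_(k < n) F k) = \sum_(k < n) L (F k).
Proof.
move=> /linear_rules lL; elim/big_rec2: _ => [|i x y _ <-]; by rewrite !lL.
Qed.

Lemma normc_Re V (v : V) : `|v| = (complex.Re `|v|)%:C.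
Proof. by rewrite RRe_real// normr_real. Qed.

Lemma Re_norm_ge0 V (v : V) : 0 <= complex.Re `|v|.
Proof. by have := normr_ge0 v; rewrite lecE => /andP[]. Qed.

(** Replacing [M] by its modulus is harmless: [M * |v|] dominates a norm, so it is nonnegative and
    equals its own modulus. *)
Lemma bounded_linear_real V W (L : V -> W) : bounded_linear L ->
  exists2 m : R, 0 <= m & forall v, `|L v| <= m%:C * `|v|.
Proof.
move=> [_ [M LM]]; exists (complex.Re `|M|); first exact: Re_norm_ge0.
move=> v; rewrite -normc_Re -[X in _ * X]normr_id -normrM.
by rewrite ger0_norm// (le_trans _ (LM v)).
Qed.

Lemma bounded_linear_comp V W Z (L : W -> Z) (L' : V -> W) :
  bounded_linear L -> bounded_linear L' -> bounded_linear (L \o L').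
Proof.
move=> bL bL'; have [m m0 Lm] := bounded_linear_real bL.
have [m' m'0 Lm'] := bounded_linear_real bL'.
split; first by move=> a u v /=; rewrite bL'.1 bL.1.
exists (m%:C * m'%:C) => v; rewrite (le_trans (Lm _))//= -mulrA ler_wpM2l//.
by rewrite lecR.
Qed.

Lemma bounded_linearD V W (L L' : V -> W) :
  bounded_linear L -> bounded_linear L' -> bounded_linear (fun v => L v + L' v).
Proof.
move=> [lL [M LM]] [lL' [M' LM']]; split.
  by move=> a u v; rewrite lL lL' scalerDr addrACA.
by exists (M + M') => v; rewrite (le_trans (ler_normD _ _))// mulrDl lerD.
Qed.

Lemma bounded_linearZ V W (L : V -> W) (c : R[i]) :
  bounded_linear L -> bounded_linear (fun v => c *: L v).
Proof.
move=> [lL [M LM]]; split.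
  by move=> a u v; rewrite lL scalerDr !scalerA mulrC.
by exists (`|c| * M) => v; rewrite normrZ -mulrA ler_wpM2l.
Qed.

Lemma bounded_linear_id V : bounded_linear (fun v : V => v).
Proof. by split=> //; exists 1 => v; rewrite mul1r. Qed.

Lemma bounded_linear0 V W : bounded_linear (fun v : V => 0 : W).
Proof.
by split; [move=> a u v; rewrite scaler0 addr0|exists 0 => v; rewrite normr0 mul0r].
Qed.

Lemma prod_norm_le V W (x : V * W) (e : R[i]) :
  `|x.1| <= e -> `|x.2| <= e -> `|x| <= e.
Proof. by move=> h1 h2; rewrite prod_normE /Order.max; case: ifP. Qed.

Lemma norm_fst V W (x : V * W) : `|x.1| <= `|x|.
Proof.
by rewrite prod_normE comparable_le_max ?lexx//; apply: real_comparable; exact: normr_real.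
Qed.

Lemma norm_snd V W (x : V * W) : `|x.2| <= `|x|.
Proof.
rewrite prod_normE comparable_le_max ?lexx ?orbT//.
by apply: real_comparable; exact: normr_real.
Qed.

Lemma bounded_linear_fst V W : bounded_linear (fun x : V * W => x.1).
Proof. by split=> //; exists 1 => v; rewrite mul1r norm_fst. Qed.

Lemma bounded_linear_snd V W : bounded_linear (fun x : V * W => x.2).
Proof. by split=> //; exists 1 => v; rewrite mul1r norm_snd. Qed.

Lemma bounded_linear_pair V W Z (L : V -> W) (L' : V -> Z) :
  bounded_linear L -> bounded_linear L' -> bounded_linear (fun v => (L v, L' v)).
Proof.
move=> bL bL'; have [m m0 Lm] := bounded_linear_real bL.
have [m' m'0 Lm'] := bounded_linear_real bL'.
split; first by move=> a u v; rewrite bL.1 bL'.1.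
exists (m + m')%:C => v; apply: prod_norm_le => /=.
  by rewrite (le_trans (Lm _))// ler_wpM2r// lecR lerDl.
by rewrite (le_trans (Lm' _))// ler_wpM2r// lecR lerDr.
Qed.

Lemma op_cvg_comp V Y W Z (u : nat -> V -> W) (E : V -> W)
    (L : W -> Z) (L' : Y -> V) :
  bounded_linear L -> bounded_linear L' -> op_cvg u E ->
  op_cvg (fun n => L \o u n \o L') (L \o E \o L').
Proof.
move=> bL bL' uE; have [m m0 Lm] := bounded_linear_real bL.
have [m' m'0 Lm'] := bounded_linear_real bL'.
(* The summand 1 keeps the divisor positive when one of the bounds vanishes. *)
move=> e e0; have d0 : 0 < m * m' + 1 by rewrite ltr_wpDl// mulr_ge0.
have := uE (e / (m * m' + 1)) (divr_gt0 e0 d0).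
apply: filterS => n un v /=; rewrite -(linear_rules bL.1) (le_trans (Lm _))//.
have := un (L' v); move/(@ler_wpM2l _ m%:C); rewrite lecR => /(_ m0) /le_trans; apply.
have dc0 : 0 <= (e / (m * m' + 1))%:C :> R[i] by rewrite lecR divr_ge0// ltW.
have := Lm' v; move/(@ler_wpM2l _ _ dc0)/(@ler_wpM2l _ m%:C).
rewrite lecR => /(_ m0)/le_trans; apply.
rewrite !mulrA ler_wpM2r// -!rmorphM/= lecR.
have -> : m * (e / (m * m' + 1)) * m' = e * (m * m' / (m * m' + 1)) by ring.
by rewrite ger_pMr// ler_pdivrMr// mul1r lerDl.
Qed.

Lemma op_cvgD V W (u u' : nat -> V -> W) (E E' : V -> W) :
  op_cvg u E -> op_cvg u' E' -> op_cvg (fun n v => u n v + u' n v) (fun v => E v + E' v).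
Proof.
move=> uE uE' e e0; have e20 : 0 < e / 2 by rewrite divr_gt0.
apply: filterS2 (uE _ e20) (uE' _ e20) => n un un' v.
rewrite opprD addrACA (le_trans (ler_normD _ _))//.
by rewrite [in leRHS](splitr e) rmorphD mulrDl lerD.
Qed.

Lemma analytic_op_cst V W (L : V -> W) : bounded_linear L -> analytic_op (fun=> L).
Proof.
move=> bL z0; exists (fun k => if k is 0%N then L else fun=> 0), 1; split=> //.
  by case=> [|k] //; exact: bounded_linear0.
move=> z _ e e0; near=> n; move=> v.
(* The empty sum at [n = 0] misses the constant term, so [n] is taken positive. *)
have -> : n = n.-1.+1 by rewrite prednK//; near: n; exact: nbhs_infty_gt.
rewrite big_ord_recl/= expr0 scale1r big1 ?addr0 ?subrr ?normr0.
  by rewrite mulr_ge0// lecR ltW.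
by move=> i _; rewrite scaler0.
Unshelve. all: by end_near. Qed.

Lemma analytic_opD V W (E E' : R[i] -> V -> W) :
  analytic_op E -> analytic_op E' -> analytic_op (fun z v => E z v + E' z v).
Proof.
move=> aE aE' z0; have [a [r [r0 ba Ea]]] := aE z0; have [a' [r' [r'0 ba' Ea']]] := aE' z0.
exists (fun k v => a k v + a' k v), (Num.min r r'); split.
- by rewrite lt_min r0.
- by move=> k; exact: bounded_linearD.
move=> z zr; have zr1 : `|z - z0| < r%:C.
  by rewrite (lt_le_trans zr)// lecR ge_min lexx.
have zr2 : `|z - z0| < r'%:C by rewrite (lt_le_trans zr)// lecR ge_min lexx orbT.
have := op_cvgD (Ea z zr1) (Ea' z zr2).
congr op_cvg; apply/funext => n; apply/funext => v.
by rewrite -big_split/=; apply: eq_bigr => k _; rewrite scalerDr.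
Qed.

Lemma analytic_op_comp V Y W Z (E : R[i] -> V -> W) (L : W -> Z) (L' : Y -> V) :
  bounded_linear L -> bounded_linear L' -> analytic_op E ->
  analytic_op (fun z => L \o E z \o L').
Proof.
move=> bL bL' aE z0; have [a [r [r0 ba Ea]]] := aE z0.
exists (fun k => L \o a k \o L'), r; split=> //.
  by move=> k; exact: (bounded_linear_comp (bounded_linear_comp bL (ba k)) bL').
move=> z zr; have := op_cvg_comp bL bL' (Ea z zr).
congr op_cvg; apply/funext => n; apply/funext => v /=.
rewrite linear_sum; last exact: bL.1.
by apply: eq_bigr => k _; rewrite (linear_rules bL.1).
Qed.

(** Writing [z = z0 + (z - z0)] gives the coefficients [z0 a_k + a_(k-1)]. The partial sum of length
    [n + 1] then involves those of [E] of lengths [n + 1] and [n], whence the threshold [n0.+1]. *)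
Lemma analytic_opZ V W (E : R[i] -> V -> W) :
  analytic_op E -> analytic_op (fun z v => z *: E z v).
Proof.
move=> aE z0; have [a [r [r0 ba Ea]]] := aE z0.
pose b k v := z0 *: a k v + (if k is k'.+1 then a k' v else 0).
exists b, r; split=> //.
  move=> k; apply: bounded_linearD; first exact: bounded_linearZ.
  by case: k => [|k]; [exact: bounded_linear0|exact: ba].
move=> z zr.
pose S n v := \sum_(k < n) (z - z0) ^+ k *: a k v.
have bS n v : \sum_(k < n.+1) (z - z0) ^+ k *: b k v = z0 *: S n.+1 v + (z - z0) *: S n v.
  under eq_bigr do rewrite scalerDr; rewrite big_split/=; congr (_ + _).
    by rewrite scaler_sumr; apply: eq_bigr => k _; rewrite !scalerA mulrC.
  rewrite big_ord_recl scaler0 add0r scaler_sumr; apply: eq_bigr => k _.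
  by rewrite scalerA -exprS.
move=> e e0; pose M := complex.Re `|z0| + complex.Re `|z - z0| + 1.
have M0 : 0 < M.
  by rewrite ltr_wpDl// addr_ge0// Re_norm_ge0.
have eM : 0 < e / M by rewrite divr_gt0.
have [n0 _ Hn] := Ea z zr _ eM.
exists n0.+1 => // -[//|n] /=; rewrite ltnS => n0n v; rewrite bS.
have -> : z *: E z v = z0 *: E z v + (z - z0) *: E z v.
  by rewrite -scalerDl addrC subrK.
rewrite opprD addrACA -!scalerBr (le_trans (ler_normD _ _))// !normrZ.
have h1 : `|S n.+1 v - E z v| <= (e / M)%:C * `|v| by apply: Hn => /=; rewrite ltnW.
have h2 : `|S n v - E z v| <= (e / M)%:C * `|v| by exact: Hn.
apply: (@le_trans _ _ ((`|z0| + `|z - z0|) * ((e / M)%:C * `|v|))).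
  by rewrite mulrDl lerD// ler_wpM2l.
rewrite mulrA ler_wpM2r// [`|z0|]normc_Re [`|_ - _|]normc_Re -rmorphD -rmorphM lecR/=.
by rewrite mulrC -mulrA ger_pMr// ler_pdivrMl// mulr1 lerDl.
Qed.


Lemma cvg_half_pow (p e : R) : 0 < e ->
  \forall n \near \oo, p * (1 / 2) ^+ n <= e.
Proof.
move=> e0; have h : `|1 / 2 : R| < 1 by rewrite ger0_norm ?ltr_pdivrMr// mul1r ltr1n.
have /cvgrPdist_le/(_ _ e0) := cvg_geometric p h.
by apply: filterS => n; rewrite sub0r normrN => /(le_trans (ler_norm _)).
Qed.

Lemma iter_bound V (L : V -> V) (m : R) : 0 <= m ->
  (forall v, `|L v| <= m%:C * `|v|) ->
  forall n v, `|iter n L v| <= (m ^+ n)%:C * `|v|.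
Proof.
move=> m0 Lm; elim=> [|n IH] v; first by rewrite expr0 mul1r.
rewrite iterS (le_trans (Lm _))// exprS rmorphM -mulrA ler_wpM2l//.
by rewrite lecR.
Qed.

(** Iterating [P z = P z0 + (z - z0) P z L P z0] yields the coefficients [P z0 (L P z0)^k] with the
    exact remainder [(z - z0)^n P z (L P z0)^n]. As [z] is fixed, any bound of [P z] will do, and no
    uniformity in [z] is required. The radius makes [|z - z0| m] at most [1/2]. *)
Lemma analytic_resolvent V (L : V -> V) (P : R[i] -> V -> V) :
  bounded_linear L -> (forall z, bounded_linear (P z)) ->
  (forall z, cancel (fun v => v - z *: L v) (P z)) ->
  (forall z, cancel (P z) (fun v => v - z *: L v)) ->
  analytic_op P.
Proof.
move=> bL bP LP PL z0.
have bLP := bounded_linear_comp bL (bP z0).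
have [m m0 Lm] := bounded_linear_real bLP.
pose q := L \o P z0; have d0 : 0 < 2 * (m + 1) by rewrite mulr_gt0// ltr_wpDl.
exists (fun k => P z0 \o iter k q), (2 * (m + 1))^-1; split; first by rewrite invr_gt0.
  move=> k; apply: bounded_linear_comp => //; elim: k => [|k IH].
    exact: bounded_linear_id.
  exact: (bounded_linear_comp bLP IH).
move=> z zr.
have step x : P z x = P z0 x + (z - z0) *: P z (q x).
  apply: (can_inj (LP z)).
  have lL := linear_rules bL.1; rewrite PL lL lL scalerDr opprD addrACA.
  rewrite scalerA [z * _]mulrC -scalerA -[(z - z0) *: _ - _]scalerBr PL.
  by rewrite scalerBl addrA subrK; exact: esym (PL z0 x).
have expn n v : P z v =
    \sum_(k < n) (z - z0) ^+ k *: (P z0 \o iter k q) v + (z - z0) ^+ n *: P z (iter n q v).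
  elim: n => [|n IH]; first by rewrite big_ord0 add0r expr0 scale1r.
  by rewrite big_ord_recr/= IH -addrA; congr (_ + _); rewrite exprSr step scalerDr scalerA.
have [p p0 Pp] := bounded_linear_real (bP z).
move=> e e0; apply: filterS (cvg_half_pow p e0) => n pn v.
rewrite (expn n v) opprD addrA subrr sub0r normrN normrZ.
apply: (@le_trans _ _ ((p * (1 / 2) ^+ n)%:C * `|v|)); last first.
  by rewrite ler_wpM2r// lecR.
rewrite normrX; apply: (@le_trans _ _ (`|z - z0| ^+ n * (p%:C * ((m ^+ n)%:C * `|v|)))).
  rewrite ler_wpM2l ?exprn_ge0// (le_trans (Pp _))// ler_wpM2l ?lecR//.
  exact: iter_bound.
have [c c0 zc] : exists2 c : R, 0 <= c & `|z - z0| = c%:C.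
  by exists (complex.Re `|z - z0|); [exact: Re_norm_ge0|exact: normc_Re].
rewrite !mulrA ler_wpM2r// zc -!rmorphXn -!rmorphM/= lecR.
rewrite [_ * p]mulrC -mulrA ler_wpM2l// -exprMn lerXn2r ?nnegrE ?mulr_ge0//.
move: zr; rewrite zc ltcR -[(_)^-1]mul1r ltr_pdivlMr// => /ltW h.
by rewrite ler_pdivlMr// (le_trans _ h)// -mulrA ler_wpM2l// mulrC ler_wpM2l// lerDl.
Qed.

Lemma mx_norm_leP m n (M : 'M[R[i]]_(m, n)) (e : R[i]) : 0 <= e ->
  (forall i j, `|M i j| <= e) -> `|M| <= e.
Proof.
move=> e0 Me; have [->|/mx_norm_neq0[[i j] /= Mij]] := eqVneq `|M| 0 => //.
by rewrite /Num.norm/= Mij.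
Qed.

Lemma mx_norm_entry m n (M : 'M[R[i]]_(m, n)) i j : `|M i j| <= `|M|.
Proof.
rewrite [leRHS]/Num.norm/= mx_normE -[leLHS]nngE num_le.
exact: (le_bigmax _ (fun ij => `|M ij.1 ij.2|%:nng) (i, j)).
Qed.

(** Evaluating the operator expansion at the unit vectors gives the columns of the matrix expansion,
    uniformly over the finitely many entries. *)
Lemma analytic_op_matrix n (E : R[i] -> 'cV[R[i]]_n -> 'cV[R[i]]_n)
    (Delta : R[i] -> 'M[R[i]]_n) :
  analytic_op E -> (forall z u, E z u = Delta z *m u) -> analytic Delta.
Proof.
move=> aE ED z0; have [a [r [r0 ba Ea]]] := aE z0.
exists (fun k => \matrix_(i, j) a k (delta_mx j 0) i 0), r; split=> //.
move=> z zr; apply/cvgrPdist_le => e /posc[e0 ->].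
apply: filterS (Ea z zr _ e0) => k Ek; apply: mx_norm_leP; first by rewrite lecR ltW.
move=> i j; have := Ek (delta_mx j 0); rewrite ED -opprB normrN => /(le_trans (mx_norm_entry _ i 0)).
have d1 : `|delta_mx j 0 : 'cV[R[i]]_n| <= 1.
  apply: mx_norm_leP => // i' j'; rewrite mxE; case: (_ && _); by rewrite ?normr1 ?normr0.
have ec : 0 <= (complex.Re e)%:C :> R[i] by rewrite lecR ltW.
move=> /le_trans/(_ (ler_wpM2l ec d1)); rewrite mulr1; congr (`|_| <= _).
rewrite !mxE (bigD1 j)//= mxE !eqxx mulr1 big1 ?addr0; last first.
  by move=> l lj; rewrite mxE (negbTE lj) mulr0.
rewrite /series/= big_mkord !summxE; congr (_ - _); apply: eq_bigr => l _.
by rewrite !mxE.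
Qed.

End bounded_operator_theory.

(** * Neumann series and Schur complement *)

Section characteristic_matrix.
Context {R : realType}.

Lemma neumann_surjective (V : completeNormedModType R[i]) (L : V -> V) (C : R) :
  bounded_linear L -> 0 <= C ->
  (forall k v, `|iter k L v| <= (C * (1 / 2) ^+ k)%:C * `|v|) ->
  forall v, exists u, u - L u = v.
Proof.
move=> bL C0 LC v.
pose S n := \sum_(k < n) iter k L v.
pose K := C * complex.Re `|v|.
have K0 : 0 <= K by rewrite mulr_ge0// Re_norm_ge0.
have Lk k : `|iter k L v| <= (K * (1 / 2) ^+ k)%:C.
  by rewrite (le_trans (LC k v))// [`|v|]normc_Re -rmorphM/= lecR mulrAC.
have h0 n : 0 <= (1 / 2 : R) ^+ n by rewrite exprn_ge0.
(* The right-hand side is the exact value of the geometric sum of [K / 2^i] for [n <= i < n + j], so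
   the induction closes with an equality. *)
have SB n j : `|S (n + j)%N - S n| <= (2 * K * (1 / 2) ^+ n * (1 - (1 / 2) ^+ j))%:C.
  elim: j => [|j IH]; first by rewrite addn0 !subrr normr0 mulr0.
  rewrite addnS /S big_ord_recr/= -/(S _) addrAC (le_trans (ler_normD _ _))//.
  apply: le_trans (lerD IH (Lk (n + j)%N)) _; rewrite -rmorphD/= lecR exprD exprS.
  by rewrite le_eqVlt; apply/orP; left; apply/eqP; field.
have SC : cvgn S.
  apply: cauchy_cvg; apply: cauchy_exP => e /posc[e0 ->].
  have e20 : 0 < complex.Re e / 2 by rewrite divr_gt0.
  have [n _ Hn] := cvg_half_pow (2 * K) e20.
  exists (S n), n => // m /= nm; rewrite -ball_normE /= distrC -(subnKC nm).
  apply: le_lt_trans (SB _ _) _; rewrite ltcR.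
  apply: (@le_lt_trans _ _ (complex.Re e / 2)); last by rewrite ltr_pdivrMr// ltr_pMr// ltr1n.
  apply: le_trans (Hn n _); last exact: leqnn.
  apply: ler_piMr; last by rewrite lerBlDr lerDl h0.
  by rewrite mulr_ge0// mulr_ge0.
have ST n : S n - L (S n) = v - iter n L v.
  elim: n => [|n IH]; first by rewrite /S big_ord0 (linear_rules bL.1) !subrr.
  rewrite /S big_ord_recr/= -/(S n) (linear_rules bL.1) opprD addrACA IH.
  by rewrite addrA subrK.
exists (limn S); apply/eqP; rewrite -subr_eq0 -normr_le0.
have [m m0 Lm] := bounded_linear_real bL.
rewrite normc_Re lecR; apply/ler_addgt0Pl => e e0; rewrite addr0.
have d0 : 0 < e / (m + 2) by rewrite divr_gt0// ltr_wpDl.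
have dc0 : 0 < (e / (m + 2))%:C by rewrite ltcR.
have /cvgrPdist_le/(_ _ dc0) Sd := SC.
have [n [Sn Kn]] := filter_ex (filterI Sd (cvg_half_pow K d0)).
rewrite -lecR -normc_Re.
(* The partial sum [S n] solves the equation up to [iter n L v]. The three summands are at most [d],
   [m d] and [d] with [d = e / (m + 2)], which explains that divisor. *)
have -> : limn S - L (limn S) - v = (limn S - S n) + L (S n - limn S) - iter n L v.
  have vE : v = S n - L (S n) + iter n L v by rewrite ST subrK.
  rewrite {1}vE opprD addrA (linear_rules bL.1); congr (_ - _).
  by rewrite opprB [L (S n) - S n]addrC addrACA [- L _ + _]addrC.
apply: le_trans (ler_normB _ _) _.
apply: le_trans (lerD (ler_normD _ _) (Lk n)) _.
have Sn' : `|L (S n - limn S)| <= (m * (e / (m + 2)))%:C.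
  by apply: le_trans (Lm _) _; rewrite rmorphM ler_wpM2l ?lecR// distrC.
apply: le_trans (lerD (lerD Sn Sn') (lexx _)) _; rewrite -!rmorphD/= lecR.
have eE : e / (m + 2) + m * (e / (m + 2)) + e / (m + 2) = e.
  by field; rewrite gt_eqF// ltr_wpDl.
by rewrite -[leRHS]eE lerD2l.
Qed.

(** Operator counterpart of [det (1 - G C) = det (1 - C G)] with [G = z (P z) D]: it trades the
    factor [I - G C] of [I - z T], acting on [X], for the matrix [I - C G = Delta z], acting on
    [C^n]. *)
Theorem characteristic_matrix_finite_rank (X : completeNormedModType R[i]) n
    (T L : X -> X) (D : 'cV[R[i]]_n -> X) (C : X -> 'cV[R[i]]_n)
    (P : R[i] -> X -> X) (Delta : R[i] -> 'M[R[i]]_n) :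
  bounded_linear T -> bounded_linear L -> bounded_linear D -> bounded_linear C ->
  (forall v, T v = L v + D (C v)) ->
  (forall z, bounded_linear (P z)) ->
  (forall z, cancel (fun v => v - z *: L v) (P z)) ->
  (forall z, cancel (P z) (fun v => v - z *: L v)) ->
  (forall z u, Delta z *m u = u - z *: C (P z (D u))) ->
  characteristic_matrix_function T Delta.
Proof.
move=> bT bL bD bC TE bP LP PL DE.
have aP := analytic_resolvent bL bP LP PL.
have aZ := analytic_opZ aP.
have bCN : bounded_linear (fun u => - C u).
  by split; [move=> a u v; rewrite bC.1 opprD scalerN|have [M hM] := bC.2; exists M => v; rewrite normrN].
have bN : bounded_linear (fun u : X => - u).
  by split; [move=> a u v; rewrite opprD scalerN|exists 1 => v; rewrite normrN mul1r].
have lD := linear_rules bD.1.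
have CB u v : C (u - v) = C u - C v by rewrite (linear_rules bC.1).
have CD u v : C (u + v) = C u + C v by rewrite (linear_rules bC.1).
have CZ a u : C (a *: u) = a *: C u by rewrite (linear_rules bC.1).
have bDfst : bounded_linear (fun w : 'cV[R[i]]_n * X => D w.1).
  exact: (bounded_linear_comp bD (bounded_linear_fst _ _)).
have bCsnd : bounded_linear (fun w : 'cV[R[i]]_n * X => C w.2).
  exact: (bounded_linear_comp bC (bounded_linear_snd _ _)).
pose G z u := z *: P z (D u).
have GD z u v : G z (u + v) = G z u + G z v.
  by rewrite /G lD (linear_rules (bP z).1) scalerDr.
(* [G z] is [z (P z) D]; [E] and [F] are the unitriangular factors of the Schur complement. *)
pose E z (w : 'cV[R[i]]_n * X) := (w.1 + C w.2 - C (G z w.1), w.2 - G z w.1).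
pose F z (w : 'cV[R[i]]_n * X) := (w.1 - C (G z w.1 + P z w.2), G z w.1 + P z w.2).
(* Both [E] and [F] are affine in the families [z P z] and [P z], composed with fixed bounded
   operators; hence no product of two analytic families has to be expanded. *)
have aE : analytic_op E.
  have := analytic_opD (analytic_op_cst (bounded_linear_pair
      (bounded_linearD (bounded_linear_fst _ _) bCsnd) (bounded_linear_snd _ _)))
    (analytic_op_comp (bounded_linear_pair bCN bN) bDfst aZ).
  by congr analytic_op; apply/funext => z; apply/funext => w.
have aF : analytic_op F.
  have bI := bounded_linear_pair bCN (@bounded_linear_id _ X).
  have := analytic_opD (analytic_op_cst (bounded_linear_pair
      (bounded_linear_fst _ _) (@bounded_linear0 _ ('cV[R[i]]_n * X)%type X)))
    (analytic_opD (analytic_op_comp bI bDfst aZ) (analytic_op_comp bI (bounded_linear_snd _ _) aP)).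
  congr analytic_op; apply/funext => z; apply/funext => w /=.
  transitivity (w.1 + (- C (G z w.1) - C (P z w.2)), 0 + (G z w.1 + P z w.2)) => //.
  by rewrite add0r -opprD -CD.
have bG z : bounded_linear (G z).
  apply: bounded_linearZ; exact: (bounded_linear_comp (bP z) bD).
have bGfst z : bounded_linear (fun w : 'cV[R[i]]_n * X => G z w.1).
  exact: (bounded_linear_comp (bG z) (bounded_linear_fst _ _)).
have bE z : bounded_linear (E z).
  exact: (bounded_linear_pair
    (bounded_linearD (bounded_linearD (bounded_linear_fst _ _) bCsnd)
      (bounded_linear_comp bCN (bGfst z)))
    (bounded_linearD (bounded_linear_snd _ _) (bounded_linear_comp bN (bGfst z)))).
have bF z : bounded_linear (F z).
  have bS := bounded_linearD (bGfst z) (bounded_linear_comp (bP z) (bounded_linear_snd _ _)).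
  exact: (bounded_linear_pair
    (bounded_linearD (bounded_linear_fst _ _) (bounded_linear_comp bCN bS)) bS).
split=> //.
  apply: analytic_op_matrix.
    exact: (analytic_opD (analytic_op_cst (@bounded_linear_id _ _)) (analytic_op_comp bCN bD aZ)).
  by move=> z u; rewrite DE /= CZ.
exists E, F; split=> //.
- move=> z; split=> //.
  exists (fun w => (w.1 - C w.2, w.2 + G z (w.1 - C w.2))); split.
  + have bU := bounded_linearD (bounded_linear_fst _ _) (bounded_linear_comp bCN (bounded_linear_snd _ _)).
    exact: (bounded_linear_pair bU
      (bounded_linearD (bounded_linear_snd _ _) (bounded_linear_comp (bG z) bU))).
  + move=> [u v]; rewrite /E /= CB -[u + C v - _]addrA.
    by rewrite addrK subrK.
  + move=> [u v]; rewrite /E /= addrK CD addrA addrK.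
    by rewrite subrK.
- move=> z; split=> //.
  exists (fun w => (w.1 + C w.2, (fun v => v - z *: L v) (w.2 - G z (w.1 + C w.2)))); split.
  + have bU := bounded_linearD (bounded_linear_fst _ _) bCsnd.
    have bW := bounded_linearD (bounded_linear_snd _ _)
      (bounded_linear_comp bN (bounded_linear_comp (bG z) bU)).
    have bI := bounded_linearD (@bounded_linear_id _ X) (bounded_linear_comp bN (bounded_linearZ z bL)).
    exact: (bounded_linear_pair bU (bounded_linear_comp bI bW)).
  + by move=> [u v]; rewrite /F /= subrK [G z u + _]addrC addrK PL.
  + by move=> [u v]; rewrite /F /= LP [G z _ + _]addrC subrK addrK.
- move=> z [u v] /=; rewrite /F /E /= DE.
  set v' := v - G z u.
  have -> : u + C v - C (G z u) = u + C v' by rewrite /v' CB addrA.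
  (* This is [P z (I - z T) = I - G C], which follows from [T = L + D C]. *)
  have -> : P z (v' - z *: T v') = v' - G z (C v').
    rewrite TE scalerDr opprD addrA (linear_rules (bP z).1) LP.
    by rewrite (linear_rules (bP z).1).
  have -> : G z (u + C v') + (v' - G z (C v')) = v.
    by rewrite GD [v' - _]addrC addrA addrK /v' addrC subrK.
  by rewrite -CZ /v' CB addrA addrAC addrK.
Qed.

End characteristic_matrix.

(** * Bounded inverses from decaying iterates *)

Section neumann_inverse.
Context {R : realType}.

(** The a priori bound [bnd] on solutions of [u - L u = v] does everything: applied to a difference
    it gives uniqueness, hence linearity of the chosen solution map, and it also bounds that map. *)
Lemma neumann_inverse (V : completeNormedModType R[i]) (L : V -> V) (C : R) :
  bounded_linear L -> 0 <= C ->
  (forall k v, `|iter k L v| <= (C * (1 / 2) ^+ k)%:C * `|v|) ->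
  exists P : V -> V, [/\ bounded_linear P, cancel (fun v => v - L v) P &
    cancel P (fun v => v - L v)].
Proof.
move=> bL C0 LC.
have [P PP] := choice (neumann_surjective bL C0 LC).
have itB k a b : iter k L (a - b) = iter k L a - iter k L b.
  by elim: k => //= k ->; rewrite (linear_rules bL.1).
have bnd u v : u - L u = v -> `|u| <= (2 * C)%:C * `|v|.
  move=> uv.
  (* The difference telescopes to the sum of [iter k L v] over [k < n]; the bound is again an exact
     geometric sum. *)
  have expn n : `|u - iter n L u| <= (2 * C * (1 - (1 / 2) ^+ n))%:C * `|v|.
    elim: n => [|n IH]; first by rewrite /= !subrr normr0 mulr0 mul0r.
    have -> : u - iter n.+1 L u = (u - iter n L u) + iter n L v.
      by rewrite -uv itB -iterSr addrA subrK.
    apply: le_trans (ler_normD _ _) _; apply: le_trans (lerD IH (LC n v)) _.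
    rewrite -mulrDl ler_wpM2r// -rmorphD/= lecR exprS.
    by rewrite le_eqVlt; apply/orP; left; apply/eqP; field.
  have [c [c0 uc]] : exists c : R, 0 <= c /\ `|u| = c%:C.
    by exists (complex.Re `|u|); split; [exact: Re_norm_ge0|exact: normc_Re].
  have [d [d0 vd]] : exists c : R, 0 <= c /\ `|v| = c%:C.
    by exists (complex.Re `|v|); split; [exact: Re_norm_ge0|exact: normc_Re].
  rewrite uc vd -rmorphM/= lecR; apply/ler_addgt0Pl => e e0.
  have [n Hn] := filter_ex (cvg_half_pow (C * c) e0).
  have := ler_normD (u - iter n L u) (iter n L u); rewrite subrK uc.
  move=> /le_trans/(_ (lerD (expn n) (LC n u))).
  rewrite uc vd -!rmorphM -rmorphD/= lecR => /le_trans; apply.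
  have h0 : 0 <= (1 / 2 : R) ^+ n by rewrite exprn_ge0.
  have := mulr_ge0 (mulr_ge0 C0 d0) h0; nra.
have inj u u' : u - L u = u' - L u' -> u = u'.
  move=> e; apply/eqP; rewrite -subr_eq0 -normr_le0.
  have := bnd (u - u') 0; rewrite normr0 mulr0; apply.
  have -> : L (u - u') = L u - L u' by rewrite (linear_rules bL.1).
  by rewrite opprD opprK addrACA e addrACA subrr addNr addr0.
exists P; split.
- split; last by exists (2 * C)%:C => v; exact: bnd.
  move=> a u v; apply: inj; rewrite PP.
  have -> : L (a *: P u + P v) = a *: L (P u) + L (P v) by exact: bL.1.
  by rewrite opprD addrACA -scalerBr !PP.
- by move=> v; apply: inj; rewrite PP.
- by move=> v; rewrite PP.
Qed.

End neumann_inverse.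

(** * Linear differential equations *)

Section energy.
Context {R : realType}.
Implicit Types c d : R[i].

Definition csq c : R := complex.Re c ^+ 2 + complex.Im c ^+ 2.

(** The Euclidean inner product of the real plane; [2 * cdot c c'] is the derivative of [csq c]. *)
Definition cdot c d : R := complex.Re c * complex.Re d + complex.Im c * complex.Im d.

Lemma csq_ge0 c : 0 <= csq c.
Proof. by rewrite addr_ge0// sqr_ge0. Qed.

Lemma csqM c d : csq (c * d) = csq c * csq d.
Proof. by case: c d => [a b] [a' b']; rewrite /csq /=; ring. Qed.

Lemma csqD_le c d : csq (c + d) <= 2 * csq c + 2 * csq d.
Proof.
case: c d => [a b] [a' b']; rewrite /csq /=.
have := sqr_ge0 (a - a'); have := sqr_ge0 (b - b'); nra.
Qed.

Lemma cdotDr c d e : cdot c (d + e) = cdot c d + cdot c e.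
Proof. by case: c d e => [a b] [a' b'] [a'' b'']; rewrite /cdot /=; ring. Qed.

Lemma cdot_sumr n c (F : 'I_n -> R[i]) : cdot c (\sum_i F i) = \sum_i cdot c (F i).
Proof.
elim/big_rec2: _ => [|i x y _ <-]; last exact: cdotDr.
by rewrite /cdot /= !mulr0 addr0.
Qed.

Lemma cdot_le c d : 2 * cdot c d <= csq c + csq d.
Proof.
case: c d => [a b] [a' b']; rewrite /csq /cdot /=.
have := sqr_ge0 (a - a'); have := sqr_ge0 (b - b'); nra.
Qed.

Lemma csq_norm c : csq c = complex.Re `|c| ^+ 2.
Proof. by rewrite normc_def /= sqr_sqrtr// csq_ge0. Qed.

(** The squared Euclidean norm, used because the maximum norm of ['cV] is not differentiable. *)
Definition energy n (v : 'cV[R[i]]_n) : R := \sum_i csq (v i 0).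

Lemma energy_ge0 n (v : 'cV[R[i]]_n) : 0 <= energy v.
Proof. by apply: sumr_ge0 => i _; exact: csq_ge0. Qed.

(** Repeated use of [csqD_le] doubles the constant at each term. Cauchy-Schwarz would give [n], but
    only finiteness of the constant matters below. *)
Lemma csq_sum_le n (F : 'I_n -> R[i]) :
  csq (\sum_i F i) <= 2 ^+ n * \sum_i csq (F i).
Proof.
elim: n F => [|n IH] F; first by rewrite !big_ord0 /csq /= expr0n /= mulr0 addr0.
rewrite !big_ord_recl; apply: le_trans (csqD_le _ _) _; rewrite [leRHS]mulrDr; apply: lerD.
  by rewrite ler_wpM2r ?csq_ge0// exprS ler_peMr// exprn_ege1// ler1n.
by rewrite exprS -mulrA ler_wpM2l.
Qed.

Lemma natr_mul_sum n (a : R) : n%:R * a = \sum_(i < n) a.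
Proof. by rewrite sumr_const card_ord mulr_natl. Qed.

Lemma energy_mulmx_le n (M : 'M[R[i]]_n) (mu : R) v :
  (forall i j, csq (M i j) <= mu) ->
  energy (M *m v) <= n%:R * 2 ^+ n * mu * energy v.
Proof.
move=> Mmu; rewrite -!mulrA natr_mul_sum.
apply: ler_sum => i _; rewrite mxE (le_trans (csq_sum_le _))// ler_wpM2l ?exprn_ge0//.
rewrite mulr_sumr; apply: ler_sum => j _.
by rewrite csqM ler_wpM2r// csq_ge0.
Qed.

Lemma energyZ n (a : R[i]) (v : 'cV[R[i]]_n) : energy (a *: v) = csq a * energy v.
Proof. by rewrite mulr_sumr; apply: eq_bigr => i _; rewrite mxE csqM. Qed.

Lemma energy0 n : energy (0 : 'cV[R[i]]_n) = 0.
Proof. by apply: big1 => i _; rewrite mxE /csq /= expr0n /= addr0. Qed.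

Lemma energy_norm n (v : 'cV[R[i]]_n) : energy v <= n%:R * complex.Re `|v| ^+ 2.
Proof.
rewrite natr_mul_sum; apply: ler_sum => i _.
rewrite csq_norm lerXn2r ?nnegrE ?Re_norm_ge0//.
by rewrite -lecR -!normc_Re mx_norm_entry.
Qed.

Lemma norm_energy n (v : 'cV[R[i]]_n) (r : R) : 0 <= r -> energy v <= r ^+ 2 ->
  `|v| <= r%:C.
Proof.
move=> r0 vr; apply: mx_norm_leP => [|i j]; first by rewrite lecR.
rewrite normc_Re lecR -(@ler_pXn2r _ 2)// ?nnegrE ?Re_norm_ge0// -csq_norm.
apply: le_trans vr; rewrite ord1 /energy (bigD1 i)//= lerDl.
by apply: sumr_ge0 => k _; exact: csq_ge0.
Qed.

Lemma energy_eq0 n (v : 'cV[R[i]]_n) : energy v <= 0 -> v = 0.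
Proof.
move=> v0; apply/eqP; rewrite -normr_le0; apply: (@norm_energy _ _ 0) => //.
by rewrite expr0n.
Qed.

(** The left-hand side is the derivative of the energy along [v' = M v + g]. Each pair [(i, j)]
    contributes at most [|v_i|^2 + mu |v_j|^2], and the forcing contributes [|v_i|^2 + |g_i|^2]. *)
Lemma energy_growth n (M : 'M[R[i]]_n) (mu : R) (v g : 'cV[R[i]]_n) :
  (forall i j, csq (M i j) <= mu) ->
  \sum_i 2 * cdot (v i 0) ((M *m v + g) i 0) <=
    (n%:R * (1 + mu) + 1) * energy v + energy g.
Proof.
move=> Mmu.
apply: (@le_trans _ _ (\sum_i (\sum_j (csq (v i 0) + mu * csq (v j 0))
    + (csq (v i 0) + csq (g i 0))))).
  apply: ler_sum => i _; rewrite !mxE cdotDr mulrDr lerD ?cdot_le// cdot_sumr mulr_sumr.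
  apply: ler_sum => j _; rewrite (le_trans (cdot_le _ _))// lerD2l csqM.
  by rewrite ler_wpM2r// csq_ge0.
rewrite big_split /= [X in _ + X]big_split/= -/(energy v) -/(energy g) addrA lerD2r.
under eq_bigr do rewrite big_split/= -mulr_sumr sumr_const card_ord -/(energy v).
rewrite big_split/= sumr_const card_ord sumrMnl -/(energy v).
rewrite -[energy v *+ n]mulr_natl -[_ *+ n]mulr_natl.
by rewrite le_eqVlt; apply/orP; left; apply/eqP; ring.
Qed.

End energy.

(** * Gronwall's inequality with exponential forcing *)

Section gronwall.
Context {R : realType}.

(** A forcing of size [exp (lambda t)] produces a response with the same weight and the gain
    [1 / (lambda - kappa)]. Keeping [lambda] free is the point: a large [lambda] makes the gain
    small. *)
Lemma gronwall (E : R -> R) (tau kappa lambda c : R) :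
  {within `[0, tau], continuous E} ->
  (forall t, 0 < t < tau ->
     exists2 d, is_derive t 1 E d & d <= kappa * E t + c * expR (lambda * t)) ->
  kappa < lambda -> 0 <= c -> 0 <= E 0 ->
  forall t, 0 <= t <= tau -> E t <= (E 0 + c / (lambda - kappa)) * expR (lambda * t).
Proof.
move=> cE dE kl c0 E0 t /andP[t0 tt].
have lk : 0 < lambda - kappa by rewrite subr_gt0.
(* The integrating factor [exp (- kappa s)] removes the linear term, and the second summand is a
   primitive of the remaining forcing; so [Q] is nonincreasing. *)
pose Q s := E s * expR (- kappa * s) - c / (lambda - kappa) * expR ((lambda - kappa) * s).
have dexp (a s : R) : is_derive s 1 (fun s : R => expR (a * s)) (a * expR (a * s)).
  by apply: is_derive_eq; rewrite ?scaler1 /GRing.scale/= ?mulr1 mulrC.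
have dQ (s : R) : 0 < s < tau -> exists2 d, is_derive s 1 Q d & d <= 0.
  move=> /dE [d Ed dle].
  exists (d * expR (- kappa * s) + E s * (- kappa * expR (- kappa * s))
     - c / (lambda - kappa) * ((lambda - kappa) * expR ((lambda - kappa) * s))).
    have h1 := dexp (- kappa) s; have h2 := dexp (lambda - kappa) s.
    apply: is_derive_eq; rewrite /GRing.scale/=; ring.
  rewrite mulrA divfK ?gt_eqF//.
  have -> : (lambda - kappa) * s = lambda * s + - kappa * s by ring.
  rewrite expRD; have := expR_gt0 (- kappa * s); nra.
have Qt : Q t <= Q 0.
  apply: (@ler0_derive1_le_cc _ Q 0 tau) => //.
  - by move=> s; rewrite in_itv/= => /dQ[d [? ?] _].
  - move=> s; rewrite in_itv/= => /dQ[d Qd d0].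
    by rewrite derive1E derive_val.
  - have ce (a : R) : continuous (fun s : R => expR (a * s)).
      by move=> s; apply/differentiable_continuous/derivable1_diffP; have [] := dexp a s.
    have ce' (a : R) : {within `[0, tau], continuous (fun s : R => expR (a * s))}.
      exact: continuous_subspaceT.
    move=> s; apply: cvgB; apply: cvgM; [exact: cE|exact: ce'|exact: cvg_cst|exact: ce'].
  - by rewrite in_itv/= t0.
  - by rewrite in_itv/= lexx (le_trans t0).
move: Qt; rewrite /Q !mulr0 expR0 !mulr1.
have -> : (lambda - kappa) * t = lambda * t + - kappa * t by ring.
rewrite expRD; set q := c / _ => h.
have q0 : 0 <= q by rewrite divr_ge0// ltW.
have ek : expR (kappa * t) * expR (- kappa * t) = 1 by rewrite -expRD mulNr subrr expR0.
have p0 := expR_gt0 (- kappa * t).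
rewrite -(ler_pM2r p0); apply: le_trans (_ : E 0 - q + q * (expR (lambda * t) * expR (- kappa * t)) <= _).
  by rewrite -lerBlDr.
(* With [X] for this product, it remains to see that [E 0 - q + q X <= (E 0 + q) X], which holds as
   [X >= 1] and [E 0], [q] are nonnegative. *)
have : 1 <= expR (lambda * t) * expR (- kappa * t).
  by rewrite -expRD mulNr -mulrBl -expR0 ler_expR mulr_ge0// ltW.
nra.
Qed.

End gronwall.

Lemma within_continuous_sum {R : realType} (A : set R) n (f : 'I_n -> R -> R) :
  (forall i, {within A, continuous (f i)}) ->
  {within A, continuous (fun s => \sum_i f i s)}.
Proof.
move=> cf; elim: (index_enum _) => [|k r IH].
  rewrite (_ : (fun s => _) = cst 0); first by move=> s; exact: cvg_cst.
  by apply/funext => s; rewrite big_nil.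
rewrite (_ : (fun s => _) = f k \+ (fun s => \sum_(i <- r) f i s)).
  by move=> s; apply: cvgD; [exact: cf|exact: IH].
by apply/funext => s; rewrite big_cons.
Qed.

(** * Energy estimates and uniqueness for complex linear ODEs *)

Section linear_ode.
Context {R : realType} {n : nat}.
Implicit Types (w g : R -> 'cV[R[i]]_n) (M : R -> 'M[R[i]]_n).

(* [w' = M w + g] on ]0, tau[, stated for real and imaginary parts because [is_derive] wants the
   same scalars on both sides. *)
Definition csol (tau : R) M g w : Prop :=
  (forall i, {within `[0, tau], continuous (fun t => complex.Re (w t i 0))} /\
     {within `[0, tau], continuous (fun t => complex.Im (w t i 0))}) /\
  (forall t : R, 0 < t < tau -> forall i,
     is_derive t 1 (fun s => complex.Re (w s i 0)) (complex.Re ((M t *m w t + g t) i 0)) /\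
     is_derive t 1 (fun s => complex.Im (w s i 0)) (complex.Im ((M t *m w t + g t) i 0))).

Lemma csol_change tau M M' g g' w : csol tau M g w ->
  (forall t, 0 < t < tau -> M t *m w t + g t = M' t *m w t + g' t) ->
  csol tau M' g' w.
Proof. by move=> [cw dw] e; split=> // t tt i; rewrite -e//; exact: dw. Qed.

Lemma csol_lin tau M g g' w w' (a : R[i]) : csol tau M g w -> csol tau M g' w' ->
  csol tau M (fun t => a *: g t + g' t) (fun t => a *: w t + w' t).
Proof.
move=> [cw dw] [cw' dw'].
have ReE i : (fun t => complex.Re ((a *: w t + w' t) i 0)) = (fun t => complex.Re a * complex.Re (w t i 0)
    - complex.Im a * complex.Im (w t i 0) + complex.Re (w' t i 0)).
  apply/funext => t; by rewrite !mxE; case: (a) (w t i 0) (w' t i 0) => [? ?] [? ?] [? ?].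
have ImE i : (fun t => complex.Im ((a *: w t + w' t) i 0)) = (fun t => complex.Re a * complex.Im (w t i 0)
    + complex.Im a * complex.Re (w t i 0) + complex.Im (w' t i 0)).
  apply/funext => t; by rewrite !mxE; case: (a) (w t i 0) (w' t i 0) => [? ?] [? ?] [? ?].
split=> [i|t tt i].
  have [c1 c2] := cw i; have [c3 c4] := cw' i.
  rewrite ReE ImE; split.
    move=> s; apply: cvgD; last exact: c3.
    by apply: cvgB; apply: cvgM; [exact: cvg_cst|exact: c1|exact: cvg_cst|exact: c2].
  move=> s; apply: cvgD; last exact: c4.
  by apply: cvgD; apply: cvgM; [exact: cvg_cst|exact: c2|exact: cvg_cst|exact: c1].
have [d1 d2] := dw t tt i; have [d3 d4] := dw' t tt i.
have -> : M t *m (a *: w t + w' t) + (a *: g t + g' t) =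
    a *: (M t *m w t + g t) + (M t *m w' t + g' t).
  by rewrite mulmxDr -scalemxAr scalerDr addrACA.
move: (M t *m w t + g t) (M t *m w' t + g' t) d1 d2 d3 d4 => x y d1 d2 d3 d4.
split.
  rewrite ReE.
  apply: is_derive_eq; rewrite !mxE.
  by case: (a) (x i 0) (y i 0) => [? ?] [? ?] [? ?].
rewrite ImE.
apply: is_derive_eq; rewrite !mxE.
by case: (a) (x i 0) (y i 0) => [? ?] [? ?] [? ?].
Qed.

Lemma csol_gronwall tau M g w (mu lambda c : R) : csol tau M g w ->
  (forall t, 0 < t < tau -> forall i j, csq (M t i j) <= mu) ->
  (forall t, 0 < t < tau -> energy (g t) <= c * expR (lambda * t)) ->
  n%:R * (1 + mu) + 1 < lambda -> 0 <= c ->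
  forall t, 0 <= t <= tau -> energy (w t) <=
    (energy (w 0) + c / (lambda - (n%:R * (1 + mu) + 1))) * expR (lambda * t).
Proof.
move=> [cw dw] Mmu gc kl c0; apply: (@gronwall R (fun s => energy (w s)) tau) => //.
- apply: within_continuous_sum => i s; have [c1 c2] := cw i.
  by apply: cvgD; rewrite !expr2; apply: cvgM; (exact: c1 || exact: c2).
- move=> t tt; exists (\sum_i 2 * cdot (w t i 0) ((M t *m w t + g t) i 0)); last first.
    apply: le_trans (energy_growth _ _ (Mmu t tt)) _.
    by rewrite lerD2l gc.
  rewrite [fun s => energy (w s)](_ : _ = \sum_i (fun s => csq (w s i 0))); last first.
    by apply/funext => s; rewrite fct_sumE.
  apply: is_derive_sum => i; have [d1 d2] := dw t tt i.
  rewrite /csq; apply: is_derive_eq; rewrite /GRing.scale/= /cdot; ring.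
- exact: energy_ge0.
Qed.

Lemma csol_unique tau M g w w' (mu : R) : csol tau M g w -> csol tau M g w' ->
  (forall t, 0 < t < tau -> forall i j, csq (M t i j) <= mu) ->
  w 0 = w' 0 -> forall t, 0 <= t <= tau -> w t = w' t.
Proof.
move=> sw sw' Mmu w0 t tt.
have := csol_lin (-1) sw sw' => sd.
(* The difference of the solutions has zero forcing and zero initial energy, so any exponent above
   the growth rate works; this one exceeds it by 1. *)
have := csol_gronwall sd Mmu (lambda := n%:R * (1 + mu) + 2) (c := 0).
have g0 s : 0 < s < tau -> energy (-1 *: g s + g s) <= 0 * expR ((n%:R * (1 + mu) + 2) * s).
  by move=> _; rewrite scaleN1r addNr energy0 mul0r.
move=> /(_ g0); rewrite ltrD2l ltr1n => /(_ isT (lexx _) _ tt).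
rewrite w0 !scaleN1r addNr energy0 mul0r addr0 mul0r => /energy_eq0.
by rewrite addrC => /eqP; rewrite subr_eq0 => /eqP ->.
Qed.

End linear_ode.

(** * Passing between complex matrix equations and their real and imaginary parts *)

Section conversions.
Context {R : realType}.
Local Notation toC := (map_mx (real_complex R)).

Lemma is_derive_lim (f : R -> R) (t d : R) :
  (fun e : R => e^-1 * (f (t + e) - f t)) @ 0^' --> d -> is_derive t 1 f d.
Proof.
rewrite (_ : (fun e => _) = fun h => h^-1 *: ((f \o shift t) (h *: 1) - f t)); last first.
  by apply/funext => e /=; rewrite /GRing.scale/= mulr1 [t + e]addrC.
move=> fd; split; first by apply/cvg_ex; exists d.
exact/cvg_lim.
Qed.

Lemma is_Cderive_entry m n (Y : R -> 'M[R[i]]_(m, n)) t dY i j : is_Cderive Y t dY ->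
  is_derive t 1 (fun s => complex.Re (Y s i j)) (complex.Re (dY i j)) /\
  is_derive t 1 (fun s => complex.Im (Y s i j)) (complex.Im (dY i j)).
Proof.
move=> Yd.
have Yij : (fun e : R => ((e^-1)%:C *: (Y (t + e) - Y t)) i j) @ 0^' --> dY i j.
  exact: (cvg_comp _ _ Yd (@coord_continuous R[i] _ _ i j dY)).
split; apply: is_derive_lim.
- rewrite (_ : (fun e => _) =
    (fun e : R => complex.Re (((e^-1)%:C *: (Y (t + e) - Y t)) i j))); last first.
    apply/funext => e; rewrite !mxE.
    by case: (Y (t + e) i j) (Y t i j) => [a b] [c d] /=; rewrite mul0r subr0.
  exact: (cvg_comp _ _ Yij (@complexRe_continuous R _)).
- rewrite (_ : (fun e => _) =
    (fun e : R => complex.Im (((e^-1)%:C *: (Y (t + e) - Y t)) i j))); last first.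
    apply/funext => e; rewrite !mxE.
    by case: (Y (t + e) i j) (Y t i j) => [a b] [c d] /=; rewrite mul0r addr0.
  exact: (cvg_comp _ _ Yij (@complexIm_continuous R _)).
Qed.

Lemma mulmx_col_sum n (M : 'M[R[i]]_n) (u : 'cV[R[i]]_n) :
  M *m u = \sum_k u k 0 *: col k M.
Proof.
apply/colP => i; rewrite !mxE summxE; apply: eq_bigr => k _.
by rewrite !mxE mulrC.
Qed.

(** Each column of [Y] is a solution, and [Y t *m u] is a combination of columns with constant
    coefficients, so [csol_lin] applies. *)
Lemma fundamental_csol n tau (M Y : R -> 'M[R[i]]_n) (u : 'cV[R[i]]_n) :
  fundamental_solution M Y -> csol tau M (fun=> 0) (fun t => Y t *m u).
Proof.
move=> [_ dY].
have sc k : csol tau M (fun=> 0) (fun t => col k (Y t)).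
  have ReE i : (fun t => complex.Re (col k (Y t) i 0)) = (fun t => complex.Re (Y t i k)).
    by apply/funext => t; rewrite mxE.
  have ImE i : (fun t => complex.Im (col k (Y t) i 0)) = (fun t => complex.Im (Y t i k)).
    by apply/funext => t; rewrite mxE.
  split=> [i|t _ i]; rewrite ReE ImE.
    split; apply: continuous_subspaceT => t;
      apply/differentiable_continuous/derivable1_diffP.
      by have [[]] := is_Cderive_entry i k (dY t).
    by have [_ []] := is_Cderive_entry i k (dY t).
  have := is_Cderive_entry i k (dY t).
  suff -> : (M t *m Y t) i k = (M t *m col k (Y t) + 0) i 0 by [].
  by rewrite addr0 !mxE; apply: eq_bigr => l _; rewrite mxE.
rewrite (_ : (fun t => Y t *m u) = fun t => \sum_k u k 0 *: col k (Y t)); last first.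
  by apply/funext => t; exact: mulmx_col_sum.
elim: (index_enum _) => [|k r IH].
  rewrite (_ : (fun t => \sum_(k <- [::]) _) = fun=> 0); last first.
    by apply/funext => t; rewrite big_nil.
  split=> [i|t _ i]; first by rewrite !mxE; split=> s; exact: cvg_cst.
  by rewrite !mulmx0 addr0 !mxE; split; exact: is_derive_cst.
have := csol_lin (u k 0) (sc k) IH.
rewrite scaler0 addr0; congr (csol _ _ _ _); apply/funext => t.
by rewrite big_cons.
Qed.

Lemma toC_mulmx_pair n (M : 'M[R]_n) (a b : 'cV[R]_n) :
  toC M *m map2_mx (@Complex R) a b = map2_mx (@Complex R) (M *m a) (M *m b).
Proof.
apply/colP => i; rewrite !mxE; apply/eqP; rewrite eq_complex /=.
rewrite !raddf_sum /=; apply/andP; split; apply/eqP/eq_bigr => j _; rewrite !mxE /=; ring.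
Qed.

Lemma is_derive_entry n (y : R -> 'cV[R]_n) (t : R) dy i :
  is_derive t 1 y dy -> is_derive t 1 (fun s => y s i 0) (dy i 0).
Proof.
move=> [dy1 dy2]; split; first by move/derivable_mxP : dy1; apply.
by rewrite -dy2 derive_mx// mxE.
Qed.

Lemma within_coord n (A : set R) (y : R -> 'cV[R]_n) i :
  {within A, continuous y} -> {within A, continuous (fun s => y s i 0)}.
Proof.
move=> cy s; apply: (@continuous_comp _ _ _ (y : subspace A -> _) (fun M : 'cV[R]_n => M i 0)).
  exact: cy.
exact: coord_continuous.
Qed.

End conversions.

(** * Delay equations *)

Section segments.
Context {R : realType} {N : nat} {tau : R}.
Local Notation toC := (map_mx (real_complex R)).
Local Notation Seg := (set_type (`[- tau, 0]%classic : set R)).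
Local Notation X := (Cseg (- tau) 0 'cV[R[i]]_N).

(* [phi] extended by 0 outside [- tau, 0] *)
Definition cext (phi : X) : R -> 'cV[R[i]]_N := 'valL_(0 : 'cV[R[i]]_N) (phi : Seg -> _).

Lemma cextE phi (theta : Seg) : cext phi (\val theta) = phi theta.
Proof. exact: (congr1 (fun k => k theta) (valLK 0 (phi : Seg -> _))). Qed.

Lemma seg_ex (t : R) : - tau <= t <= 0 -> exists theta : Seg, \val theta = t.
Proof.
move=> tt; have ht : t \in `[- tau, 0]%classic by rewrite inE /= in_itv.
by exists (exist _ t ht).
Qed.

(** Method of steps: for [0 < t < tau] the delayed time [t - tau] lies in the initial interval, so
    the delayed value is read off [phi]. The solutions for the real and imaginary parts of [phi]
    combine into a complex one since the coefficients are real. *)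
Lemma dde_csol (A B : R -> 'M[R]_N) (phi : X) y1 y2 : 0 < tau ->
  linear_dde_ivp A B 0 (cRe phi) y1 -> linear_dde_ivp A B 0 (cIm phi) y2 ->
  csol tau (toC \o A) (fun t => toC (B t) *m cext phi (t - tau))
    (fun t => map2_mx (@Complex R) (y1 t) (y2 t)).
Proof.
move=> tau0 [e1 c1 d1 _] [e2 c2 d2 _].
have sub : `[0, tau] `<=` `[0 - tau, +oo[.
  by move=> t /=; rewrite !in_itv/= => /andP[t0 _]; rewrite andbT (le_trans _ t0)// sub0r oppr_le0 ltW.
have RE (y : R -> 'cV[R]_N) (z : R -> 'cV[R]_N) i :
    (fun t => complex.Re (map2_mx (@Complex R) (y t) (z t) i 0)) = fun t => y t i 0.
  by apply/funext => t; rewrite mxE.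
have IE (y : R -> 'cV[R]_N) (z : R -> 'cV[R]_N) i :
    (fun t => complex.Im (map2_mx (@Complex R) (y t) (z t) i 0)) = fun t => z t i 0.
  by apply/funext => t; rewrite mxE.
split=> [i|t /andP[t0 tt] i]; rewrite RE IE.
  by split; apply: within_coord; apply: continuous_subspaceW sub _.
have [theta thE] : exists theta : Seg, \val theta = t - tau.
  by apply: seg_ex; rewrite lerBrDl subrr ltW// lerBlDr add0r ltW.
have -> : cext phi (t - tau) = map2_mx (@Complex R) (y1 (t - tau)) (y2 (t - tau)).
  rewrite -thE cextE -[\val theta]add0r e1 e2 /cRe /cIm; apply/colP => j.
  by rewrite !mxE; case: (phi theta j 0).
rewrite /= !toC_mulmx_pair.
have := is_derive_entry i (d1 t t0); have := is_derive_entry i (d2 t t0).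
by rewrite !mxE.
Qed.

Lemma within_segment_continuous (V : topologicalType) (u : R -> V) :
  {within `[0, tau], continuous u} ->
  continuous (fun theta : Seg => u (tau + \val theta)).
Proof.
move=> /subspace_continuousP cu theta.
have th0 : `[0, tau]%classic (tau + \val theta).
  have := set_valP theta; rewrite /= !in_itv/= => /andP[h1 h2].
  by rewrite -lerBlDl sub0r h1 gerDl.
have cs : continuous (fun th : Seg => tau + \val th).
  have cv : continuous (fun th : Seg => \val th).
    exact: (@initial_continuous _ _ (\val : Seg -> R)).
  move=> th; apply: (@continuous_comp _ _ _ (fun th : Seg => \val th) (fun s => tau + s)).
    exact: cv.
  by apply: cvgD; [exact: cvg_cst|exact: cvg_id].
move=> U /(cu _ th0)/(cs theta) Uu.
apply: (@filterS _ (nbhs theta) _ _ _ _ Uu) => th; apply.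
have := set_valP th; rewrite /= !in_itv/= => /andP[h1 h2].
by rewrite -lerBlDl sub0r h1 gerDl.
Qed.

Lemma csol_segment M g w : csol tau M g w ->
  exists psi : X, forall theta, psi theta = w (tau + \val theta).
Proof.
move=> [cw _].
have c1 : continuous (fun theta : Seg => map_mx (@complex.Re R) (w (tau + \val theta))).
  apply: mx_continuous => i j; rewrite ord1.
  rewrite (_ : (fun t => _) = fun theta : Seg => complex.Re (w (tau + \val theta) i 0)).
    exact: (within_segment_continuous (cw i).1).
  by apply/funext => th; rewrite mxE.
have c2 : continuous (fun theta : Seg => map_mx (@complex.Im R) (w (tau + \val theta))).
  apply: mx_continuous => i j; rewrite ord1.
  rewrite (_ : (fun t => _) = fun theta : Seg => complex.Im (w (tau + \val theta) i 0)).
    exact: (within_segment_continuous (cw i).2).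
  by apply/funext => th; rewrite mxE.
exists (cpair (mkcts c1) (mkcts c2)) => theta; apply/colP => i; rewrite !mxE.
by case: (w _ i 0).
Qed.

Lemma complexification_cact (g : 'M[R]_N) (L : Cseg (- tau) 0 'cV[R]_N -> _) (phi : X) theta :
  complexification (fun psi => cact g (L psi)) phi theta = toC g *m complexification L phi theta.
Proof. by rewrite /complexification /= toC_mulmx_pair. Qed.

Lemma csol_act_segment (h : 'M[R]_N) M g w : csol tau M g w ->
  exists psi : X, forall theta, psi theta = toC h *m w (tau + \val theta).
Proof.
(* Taking the complexification of [cact h] as witness supplies the continuity of the product. *)
move=> /csol_segment[psi psiE]; exists (complexification (cact h) psi) => theta.
rewrite (complexification_cact h id) -psiE; congr (_ *m _).
by apply/colP => i; rewrite !mxE; case: (psi theta i 0).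
Qed.

Lemma real_mx_norm_entry m n (M : 'M[R]_(m, n)) i j : `|M i j| <= `|M|.
Proof.
rewrite [leRHS]/Num.norm/= mx_normrE.
exact: (le_bigmax _ (fun ij => `|M ij.1 ij.2|) (i, j)).
Qed.

Lemma continuous_mx_bounded (M : R -> 'M[R]_N) : continuous M ->
  exists2 mu : R, 0 <= mu & forall t, 0 < t < tau -> forall i j, csq (toC (M t) i j) <= mu.
Proof.
move=> cM.
have cM' : {within `[0, tau], continuous M} by exact: continuous_subspaceT.
have [m [_ Hm]] := compact_bounded (continuous_compact cM' (@segment_compact _ 0 tau)).
(* Compactness gives a bound for every number strictly above [m], hence [m + 1]; the square appears
   because [csq] is a squared modulus. *)
exists ((m + 1) ^+ 2) => [|t /andP[t0 tt] i j]; first exact: sqr_ge0.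
have := Hm (m + 1) _ (M t) _; rewrite ltrDl ltr01 => /(_ isT) => h.
rewrite /csq mxE /= expr0n /= addr0 -real_normK ?num_real//.
have {}h : `|M t i j| <= m + 1.
  by apply: le_trans (real_mx_norm_entry _ _ _) (h _); exists t => //=; rewrite in_itv/= !ltW.
by rewrite lerXn2r// nnegrE// (le_trans _ h).
Qed.

End segments.

(** * Continuity of the coefficients of the linearized equation *)

Section partial_derivatives.
Context {R : realType} {N : nat}.
Context (f : 'cV[R]_N * 'cV[R]_N -> 'cV[R]_N) (f2 : Ck 2 f).

Lemma Ck_derive_continuous u : continuous ('D_u f).
Proof.
have [_ /(_ u)[df _]] := f2.
by move=> p; apply: differentiable_continuous.
Qed.

(** [Ck] controls directional derivatives of [f] on the product space; this form lets their
    continuity pass to the partial Jacobians. *)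
Lemma partial1E a b i j : partial1 f a b i j = 'D_(delta_mx j 0, 0) f (a, b) i 0.
Proof.
rewrite mxE -deriveE; last first.
  apply: (@differentiable_comp _ _ _ _ (fun u => (u, b)) f); last exact: f2.1.
  by apply: differentiable_pair; [exact: ex_diff|exact: ex_diff].
congr ((_ : 'cV[R]_N) i 0); rewrite /derive.
have -> : (fun e : R => e^-1 *: (((fun u => f (u, b)) \o shift a) (e *: delta_mx j 0) - f (a, b))) =
    (fun e : R => e^-1 *: ((f \o shift (a, b)) (e *: (delta_mx j 0, 0)) - f (a, b))).
  apply/funext => e /=; congr (_ *: (f _ - _)).
  by congr (_, _); rewrite /= scaler0 add0r.
by [].
Qed.

Lemma partial2E a b i j : partial2 f a b i j = 'D_(0, delta_mx j 0) f (a, b) i 0.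
Proof.
rewrite mxE -deriveE; last first.
  apply: (@differentiable_comp _ _ _ _ (fun u => (a, u)) f); last exact: f2.1.
  by apply: differentiable_pair; [exact: ex_diff|exact: ex_diff].
congr ((_ : 'cV[R]_N) i 0); rewrite /derive.
have -> : (fun e : R => e^-1 *: (((fun u => f (a, u)) \o shift b) (e *: delta_mx j 0) - f (a, b))) =
    (fun e : R => e^-1 *: ((f \o shift (a, b)) (e *: (0, delta_mx j 0)) - f (a, b))).
  apply/funext => e /=; congr (_ *: (f _ - _)).
  by congr (_, _); rewrite /= scaler0 add0r.
by [].
Qed.

Lemma partials_continuous (x y : R -> 'cV[R]_N) : continuous x -> continuous y ->
  continuous (fun t => partial1 f (x t) (y t)) /\
  continuous (fun t => partial2 f (x t) (y t)).
Proof.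
move=> cx cy.
have cD u i : continuous (fun t => 'D_u f (x t, y t) i 0).
  move=> t; apply: (@continuous_comp _ _ _ (fun t => 'D_u f (x t, y t)) (fun M : 'cV[R]_N => M i 0)).
    apply: (@continuous_comp _ _ _ (fun t => (x t, y t)) ('D_u f)).
      exact: (cvg_pair (cx t) (cy t)).
    exact: Ck_derive_continuous.
  exact: coord_continuous.
split; apply: mx_continuous => i j.
  by under eq_fun do rewrite partial1E; exact: cD.
by under eq_fun do rewrite partial2E; exact: cD.
Qed.

End partial_derivatives.

(* Restatements over an abstract [V]: unifying the complete and the plain normed structure of
   [Cseg a b V] is fast here and intractable for concrete matrices. *)
Section cspace_completeness.
Context {R : realType} {a b : R} {V : completeNormedModType R[i]}.
Local Notation X := (Cseg a b V).

Lemma cspace_neumann_inverse (L : X -> X) (C : R) :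
  bounded_linear L -> 0 <= C ->
  (forall k (v : X), `|iter k L v| <= (C * (1 / 2) ^+ k)%:C * `|v|) ->
  exists P : X -> X, [/\ bounded_linear P, cancel (fun v => v - L v) P &
    cancel P (fun v => v - L v)].
Proof. exact: neumann_inverse. Qed.

Lemma cspace_characteristic_matrix n (T L : X -> X)
    (D : 'cV[R[i]]_n -> X) (C : X -> 'cV[R[i]]_n) (P : R[i] -> X -> X)
    (Delta : R[i] -> 'M[R[i]]_n) :
  bounded_linear T -> bounded_linear L -> bounded_linear D -> bounded_linear C ->
  (forall v, T v = L v + D (C v)) ->
  (forall z, bounded_linear (P z)) ->
  (forall z, cancel (fun v => v - z *: L v) (P z)) ->
  (forall z, cancel (P z) (fun v => v - z *: L v)) ->
  (forall z u, Delta z *m u = u - z *: C (P z (D u))) ->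
  characteristic_matrix_function T Delta.
Proof. exact: characteristic_matrix_finite_rank. Qed.

End cspace_completeness.

(** * The monodromy operator; in this section [h] stands for the inverse of the spatio-temporal
    symmetry *)

Section monodromy.
Context {R : realType} {N : nat} {tau : R}.
Local Notation toC := (map_mx (real_complex R)).
Local Notation Seg := (set_type (`[- tau, 0]%classic : set R)).
Local Notation X := (Cseg (- tau) 0 'cV[R[i]]_N).
Context (A B : R -> 'M[R[i]]_N) (h : 'M[R]_N) (F : R -> R[i] -> 'M[R[i]]_N) (T : X -> X).
Context (muA muB : R) (tau0 : 0 < tau)
  (Amu : forall t, 0 < t < tau -> forall i j, csq (A t i j) <= muA)
  (Bmu : forall t, 0 < t < tau -> forall i j, csq (B t i j) <= muB)
  (muA0 : 0 <= muA) (muB0 : 0 <= muB).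
Context (TP : forall phi : X, exists w,
  [/\ csol tau A (fun t => B t *m cext phi (t - tau)) w, w 0 = cext phi 0 &
      forall theta, T phi theta = toC h *m w (tau + \val theta)]).
Context (FP : forall z,
  fundamental_solution (fun t => A t + z *: (B t *m toC h)) (F ^~ z)).

Let shift_seg t : 0 <= t <= tau -> exists theta : Seg, \val theta = t - tau.
Proof. by move=> /andP[t0 tt]; apply: seg_ex; rewrite lerBrDl subrr t0 lerBlDr add0r. Qed.

Let seg0 : exists theta : Seg, \val theta = 0.
Proof. by apply: seg_ex; rewrite lexx oppr_le0 ltW. Qed.

Lemma cext_val (phi : X) (theta : Seg) t : \val theta = t -> cext phi t = phi theta.
Proof. by move=> <-; exact: cextE. Qed.

Lemma cext_lin (a : R[i]) (phi psi : X) t : - tau <= t <= 0 ->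
  cext (a *: phi + psi) t = a *: cext phi t + cext psi t.
Proof. by move=> /seg_ex[theta <-]; rewrite !cextE. Qed.

Lemma cext_energy_le (phi : X) t : - tau <= t <= 0 ->
  energy (cext phi t) <= N%:R * complex.Re `|phi| ^+ 2.
Proof.
move=> /seg_ex[theta <-]; rewrite cextE (le_trans (energy_norm _))// ler_wpM2l//.
rewrite lerXn2r ?nnegrE ?Re_norm_ge0// -lecR -!normc_Re.
exact: (csup_ub phi theta).
Qed.

Lemma cspace_norm_le (phi : X) (r : R) : 0 <= r ->
  (forall t, 0 <= t <= tau -> energy (cext phi (t - tau)) <= r ^+ 2) -> `|phi| <= r%:C.
Proof.
move=> r0 pr; apply: csup_le => [|theta]; first by rewrite lecR.
apply: norm_energy => //; rewrite -cextE.
have := set_valP theta; rewrite /= in_itv/= => /andP[h1 h2].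
have := pr (tau + \val theta); rewrite [_ - tau]addrC addKr; apply.
by rewrite -lerBlDl sub0r h1 gerDl.
Qed.

Let evalc (phi : X) : 'cV[R[i]]_N := cext phi 0.

Lemma evalc_bounded : bounded_linear evalc.
Proof.
split; first by move=> a u v; rewrite /evalc cext_lin// lexx oppr_le0 ltW.
exists 1 => v; rewrite mul1r /evalc; have [theta thE] := seg0.
by rewrite (cext_val _ thE); exact: (csup_ub v theta).
Qed.

(** The growth rate that [energy_growth] gives for [v' = A v]. Below, [cH] and [cB] bound the factor
    by which multiplication by [h] and by [B t] increases the energy. *)
Let kappa : R := N%:R * (1 + muA) + 1.
Let muH : R := \sum_i \sum_j csq (toC h i j).
Let cH : R := N%:R * 2 ^+ N * muH.
Let cB : R := N%:R * 2 ^+ N * muB.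

Let muHP i j : csq (toC h i j) <= muH.
Proof.
rewrite /muH (bigD1 i)//= (bigD1 j)//= -addrA lerDl addr_ge0//.
  by apply: sumr_ge0 => k _; exact: csq_ge0.
by apply: sumr_ge0 => k _; apply: sumr_ge0 => l _; exact: csq_ge0.
Qed.

Let cH0 : 0 <= cH.
Proof.
rewrite mulr_ge0// ?mulr_ge0 ?exprn_ge0//.
by apply: sumr_ge0 => k _; apply: sumr_ge0 => l _; exact: csq_ge0.
Qed.

Let cB0 : 0 <= cB.
Proof. by rewrite mulr_ge0// mulr_ge0// exprn_ge0. Qed.

Let energy_h (v : 'cV[R[i]]_N) : energy (toC h *m v) <= cH * energy v.
Proof. exact: energy_mulmx_le. Qed.

Let F0 u : csol tau A (fun=> 0) (fun t => F t 0 *m u).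
Proof.
apply: csol_change (fundamental_csol tau u (FP 0)) _ => t _.
by rewrite scale0r !addr0.
Qed.

Let F00 z (u : 'cV[R[i]]_N) : F 0 z *m u = u.
Proof. by rewrite (FP z).1 mul1mx. Qed.

Let exD (u : 'cV[R[i]]_N) :
  exists psi : X, forall theta, psi theta = toC h *m (F (tau + \val theta) 0 *m u).
Proof. exact: csol_act_segment (F0 u). Qed.

Let expR_ge1 (l t : R) : 0 <= l -> 0 <= t -> 1 <= expR (l * t).
Proof. by move=> l0 t0; rewrite -expR0 ler_expR mulr_ge0. Qed.

Let kappa1 : 0 <= kappa.
Proof. by rewrite addr_ge0// mulr_ge0// addr_ge0. Qed.

Section volterra.
Context (V : X -> X) (VP : forall phi : X, exists v,
  [/\ csol tau A (fun t => B t *m cext phi (t - tau)) v, v 0 = 0 &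
      forall theta, V phi theta = toC h *m v (tau + \val theta)]).

(** For the energy weighted by [exp (- lambda t)], the squared norm of [V] is at most
    [cH cB / (lambda - kappa)], which tends to 0 as [lambda] grows. The initial value [v 0 = 0] is
    what removes the term without this factor. *)
Lemma volterra_estimate phi (lambda K : R) : kappa < lambda -> 0 <= K ->
  (forall t, 0 <= t <= tau -> energy (cext phi (t - tau)) <= K * expR (lambda * t)) ->
  forall t, 0 <= t <= tau ->
    energy (cext (V phi) (t - tau)) <= cH * (cB * K / (lambda - kappa)) * expR (lambda * t).
Proof.
move=> kl K0 pK t tt; have [v [sv v0 Vv]] := VP phi.
have [theta thE] := shift_seg tt.
rewrite (cext_val _ thE) Vv (le_trans (energy_h _))// -mulrA ler_wpM2l//.
have -> : tau + \val theta = t by rewrite thE addrC subrK.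
have gc s : 0 < s < tau -> energy (B s *m cext phi (s - tau)) <= cB * K * expR (lambda * s).
  move=> ss; rewrite (le_trans (energy_mulmx_le _ (Bmu ss)))// -[leRHS]mulrA ler_wpM2l//.
  by apply: pK; case/andP: ss => /ltW-> /ltW->.
have := csol_gronwall sv Amu gc kl (mulr_ge0 cB0 K0) tt.
by rewrite v0 energy0 add0r.
Qed.

(** [V] is known only through the existence of solutions, so linearity has to come from uniqueness
    for the ODE. *)
Lemma volterra_linear : linear V.
Proof.
move=> a phi psi; apply/continuousEP => theta.
have [v [sv v0 Vv]] := VP phi; have [w [sw w0 Vw]] := VP psi.
have [u [su u0 Vu]] := VP (a *: phi + psi).
rewrite Vu; transitivity (a *: V phi theta + V psi theta) => //.
rewrite Vv Vw scalemxAr -mulmxDr; congr (_ *m _).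
have tt : 0 <= tau + \val theta <= tau.
  have := set_valP theta; rewrite /= in_itv/= => /andP[h1 h2].
  by rewrite -lerBlDl sub0r h1 gerDl.
have svw : csol tau A (fun t => B t *m cext (a *: phi + psi) (t - tau)) (fun t => a *: v t + w t).
  apply: csol_change (csol_lin a sv sw) _ => t /andP[t0 t1]; congr (_ + _).
  rewrite cext_lin; first by rewrite mulmxDr -scalemxAr.
  by rewrite lerBrDl subrr ltW// lerBlDr add0r ltW.
by have := csol_unique su svw Amu _ tt; apply; rewrite u0 v0 w0 scaler0 addr0.
Qed.

Lemma volterra_iter phi (lambda : R) z k : kappa < lambda ->
  csq z * (cH * (cB / (lambda - kappa))) <= (1 / 2) ^+ 2 ->
  forall t, 0 <= t <= tau ->
  energy (cext (iter k (fun u => z *: V u) phi) (t - tau)) <=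
    (1 / 2) ^+ 2 ^+ k * (N%:R * complex.Re `|phi| ^+ 2) * expR (lambda * t).
Proof.
move=> kl zl; elim: k => [|k IH] t tt.
  rewrite expr0 mul1r (le_trans (cext_energy_le _ _))//.
    by move/andP: tt => [t0 t1]; rewrite lerBrDl subrr t0 lerBlDr add0r.
  rewrite ler_peMr//; first by rewrite mulr_ge0// sqr_ge0.
  by apply: expR_ge1; [exact: le_trans (ltW kl)|case/andP: tt].
rewrite iterS; set psi := iter k _ phi.
have -> : cext (z *: V psi) (t - tau) = z *: cext (V psi) (t - tau).
  by have [theta <-] := shift_seg tt; rewrite !cextE.
rewrite energyZ; set K := (1 / 2) ^+ 2 ^+ k * _ in IH.
have K0 : 0 <= K by rewrite mulr_ge0// ?exprn_ge0// mulr_ge0// sqr_ge0.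
have := volterra_estimate kl K0 IH tt => /(ler_wpM2l (csq_ge0 z))/le_trans; apply.
have -> : csq z * (cH * (cB * K / (lambda - kappa)) * expR (lambda * t)) =
    csq z * (cH * (cB / (lambda - kappa))) * K * expR (lambda * t) by ring.
apply: (@le_trans _ _ ((1 / 2) ^+ 2 * K * expR (lambda * t))).
  by rewrite ler_wpM2r ?expR_ge0// ler_wpM2r.
by rewrite /K [_ ^+ k.+1]exprS -!mulrA.
Qed.

Lemma volterra_bounded : bounded_linear V.
Proof.
split; first exact: volterra_linear.
pose lambda := kappa + 1; pose c := cH * (cB / (lambda - kappa)).
have c0 : 0 <= c by rewrite mulr_ge0// divr_ge0// /lambda addrAC subrr add0r.
(* On [[0, tau]] the weight lies between 1 and [exp (lambda tau)], and [N] bounds the energy by the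
   squared maximum norm. *)
pose C2 := c * N%:R * expR (lambda * tau).
have C20 : 0 <= C2 by rewrite mulr_ge0 ?expR_ge0// mulr_ge0.
exists (Num.sqrt C2)%:C => phi; rewrite [`|phi|]normc_Re -rmorphM.
apply: cspace_norm_le => [|t tt]; first by rewrite mulr_ge0 ?sqrtr_ge0 ?Re_norm_ge0.
have kl : kappa < lambda by rewrite ltrDl.
have l0 : 0 <= lambda by exact: le_trans (ltW kl).
pose K := N%:R * complex.Re `|phi| ^+ 2.
have K0 : 0 <= K by rewrite mulr_ge0// sqr_ge0.
have pK s : 0 <= s <= tau -> energy (cext phi (s - tau)) <= K * expR (lambda * s).
  move=> /andP[s0 s1]; apply: (le_trans (cext_energy_le _ _)).
    by rewrite lerBrDl subrr s0 lerBlDr add0r.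
  by rewrite ler_peMr//; apply: expR_ge1.
apply: le_trans (volterra_estimate kl K0 pK tt) _.
rewrite exprMn sqr_sqrtr//.
have -> : cH * (cB * K / (lambda - kappa)) = c * K by rewrite /c; ring.
have -> : C2 * complex.Re `|phi| ^+ 2 = c * K * expR (lambda * tau) by rewrite /C2 /K; ring.
apply: ler_wpM2l; first exact: mulr_ge0.
by rewrite ler_expR ler_wpM2l//; case/andP: tt.
Qed.

Lemma volterra_resolvent z : exists P : X -> X,
  [/\ bounded_linear P, cancel (fun v => v - z *: V v) P &
      cancel P (fun v => v - z *: V v)].
Proof.
pose c := csq z * cH * cB; have c0 : 0 <= c by rewrite mulr_ge0// mulr_ge0// csq_ge0.
(* The squared weighted norm of [z V] becomes at most [c / (1 + 4 c) <= 1/4], while the summand 1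
   keeps [lambda - kappa] positive when [c = 0]. *)
pose lambda := kappa + (1 + 4 * c).
have lk : lambda - kappa = 1 + 4 * c by rewrite /lambda addrAC subrr add0r.
have kl : kappa < lambda by rewrite ltrDl; nra.
have zl : csq z * (cH * (cB / (lambda - kappa))) <= (1 / 2) ^+ 2.
  rewrite lk; have -> : csq z * (cH * (cB / (1 + 4 * c))) = c / (1 + 4 * c) by rewrite /c; ring.
  rewrite ler_pdivrMr; nra.
have l0 : 0 <= lambda by exact: le_trans (ltW kl).
pose C2 := N%:R * expR (lambda * tau).
have C20 : 0 <= C2 by rewrite mulr_ge0 ?expR_ge0.
have bzV := bounded_linearZ z volterra_bounded.
have it k (phi : X) : `|iter k (fun u => z *: V u) phi| <=
    (Num.sqrt C2 * (1 / 2) ^+ k)%:C * `|phi|.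
  rewrite [`|phi|]normc_Re -rmorphM; set r := complex.Re _.
  have r0 : 0 <= r by exact: Re_norm_ge0.
  apply: cspace_norm_le => [|t tt]; first by rewrite !mulr_ge0 ?sqrtr_ge0 ?exprn_ge0.
  apply: le_trans (volterra_iter phi k kl zl tt) _; rewrite -/r.
  have sqM (x y w : R) : (x * y * w) ^+ 2 = x ^+ 2 * y ^+ 2 * w ^+ 2 by ring.
  rewrite sqM sqr_sqrtr// [((1 / 2) ^+ k) ^+ 2]exprAC; set Q := (1 / 2) ^+ 2 ^+ k.
  have Q0 : 0 <= Q by rewrite exprn_ge0.
  have -> : C2 * Q * r ^+ 2 = Q * (N%:R * r ^+ 2) * expR (lambda * tau) by rewrite /C2; ring.
  apply: ler_wpM2l; first by rewrite !mulr_ge0 ?sqr_ge0.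
  by rewrite ler_expR ler_wpM2l//; case/andP: tt.
exact: (cspace_neumann_inverse bzV (sqrtr_ge0 C2) it).
Qed.

End volterra.

Theorem monodromy_characteristic_matrix :
  characteristic_matrix_function T (fun z => 1%:M - z *: (toC h *m F tau z)).
Proof.
have [D DP] := choice exD.
have seg_t (theta : Seg) : 0 <= tau + \val theta <= tau.
  have := set_valP theta; rewrite /= in_itv/= => /andP[h1 h2].
  by rewrite -lerBlDl sub0r h1 gerDl.
pose V phi := T phi - D (evalc phi).
have VP phi : exists v,
  [/\ csol tau A (fun t => B t *m cext phi (t - tau)) v, v 0 = 0 &
      forall theta, V phi theta = toC h *m v (tau + \val theta)].
  have [w [sw w0 Tw]] := TP phi.
  (* [F t 0] is the fundamental solution of [v' = A v]; subtracting the homogeneous solution with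
     the same initial value leaves the one starting at 0. *)
  exists (fun t => -1 *: (F t 0 *m evalc phi) + w t); split.
  - apply: csol_change (csol_lin (-1) (F0 (evalc phi)) sw) _ => t _.
    by rewrite scaler0 add0r.
  - by rewrite F00 w0 scaleN1r addNr.
  - move=> theta; rewrite mulmxDr -scalemxAr scaleN1r addrC -Tw -DP.
    by [].
have bV := volterra_bounded VP.
have bD : bounded_linear D.
  split.
    move=> a u v; apply/continuousEP => theta.
    transitivity (a *: D u theta + D v theta) => //.
    by rewrite !DP !mulmxDr -!scalemxAr.
  pose lambda := kappa + 1; pose C2 := cH * (N%:R * expR (lambda * tau)).
  have C20 : 0 <= C2 by rewrite mulr_ge0// mulr_ge0// expR_ge0.
  have kl : kappa < lambda by rewrite ltrDl.
  have l0 : 0 <= lambda by exact: le_trans (ltW kl).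
  exists (Num.sqrt C2)%:C => u; have uN := energy_norm u.
  rewrite [`|u|]normc_Re -rmorphM; set r := complex.Re _ in uN *.
  have r0 : 0 <= r by exact: Re_norm_ge0.
  apply: cspace_norm_le => [|t tt]; first by rewrite mulr_ge0 ?sqrtr_ge0.
  have [theta thE] := shift_seg tt.
  rewrite (cext_val _ thE) DP thE [tau + _]addrC subrK exprMn sqr_sqrtr//.
  apply: le_trans (energy_h _) _.
  have -> : C2 * r ^+ 2 = cH * (N%:R * r ^+ 2 * expR (lambda * tau)) by rewrite /C2; ring.
  apply: ler_wpM2l => //.
  have g0 s : 0 < s < tau -> energy (0 : 'cV[R[i]]_N) <= 0 * expR (lambda * s).
    by rewrite energy0 mul0r.
  apply: le_trans (csol_gronwall (F0 u) Amu g0 kl (lexx _) tt) _.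
  rewrite F00 mul0r addr0 ler_pM ?energy_ge0 ?expR_ge0//.
  by rewrite ler_expR ler_wpM2l//; case/andP: tt.
have TE phi : T phi = V phi + D (evalc phi) by rewrite /V subrK.
have bT : bounded_linear T.
  have := bounded_linearD bV (bounded_linear_comp bD evalc_bounded).
  by congr bounded_linear; apply/funext => phi; rewrite TE.
have [P PP] := choice (volterra_resolvent VP).
apply: (cspace_characteristic_matrix bT bV bD evalc_bounded TE (P := P)).
- by move=> z; have [] := PP z.
- by move=> z; have [] := PP z.
- by move=> z; have [] := PP z.
move=> z u; rewrite mulmxBl mul1mx -scalemxAl; congr (_ - z *: _).
have [phi phiE] : exists phi : X, forall theta, phi theta = toC h *m (F (tau + \val theta) z *m u).
  exact: csol_act_segment (fundamental_csol tau u (FP z)).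
suff -> : P z (D u) = phi.
  rewrite /evalc; have [theta thE] := seg0.
  by rewrite (cext_val _ thE) phiE thE addr0 mulmxA.
(* It remains to check [D u = phi - z V phi], with no need for a formula for [P z]. *)
have [_ VPK _] := PP z; rewrite -[RHS]VPK; congr (P z _).
apply/continuousEP => theta.
have [v [sv v0 Vv]] := VP phi.
transitivity (phi theta - z *: V phi theta) => //.
rewrite DP phiE Vv scalemxAr -mulmxBr; congr (_ *m _).
have sF := fundamental_csol tau u (FP z).
(* The [z]-dependent part of the coefficient is moved into the forcing. There [h F(t, z) u] is
   [phi (t - tau)], so the forcing is [z] times the one that defines [V phi]. *)
have sF' : csol tau A (fun t => z *: (B t *m (toC h *m (F t z *m u)))) (fun t => F t z *m u).
  apply: csol_change sF _ => t _.
  by rewrite addr0 mulmxDl -scalemxAl !mulmxA.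
(* The two forcings cancel, and as [v 0 = 0] the initial value is [u]; by uniqueness this function
   is [F t 0 *m u], the one behind [D u]. *)
have sD : csol tau A (fun=> 0) (fun t => - z *: v t + F t z *m u).
  apply: csol_change (csol_lin (- z) sv sF') _ => t /andP[t0 t1]; congr (_ + _).
  have [th thE] : exists th : Seg, \val th = t - tau by apply: shift_seg; rewrite !ltW.
  by rewrite (cext_val _ thE) phiE thE [tau + _]addrC subrK scaleNr addNr.
have := csol_unique (F0 u) sD Amu _ (seg_t theta).
by rewrite !F00 v0 scaler0 add0r => /(_ erefl) ->; rewrite scaleNr addrC.
Qed.

End monodromy.

(** * The linearization along the periodic solution *)

Unset Implicit Arguments.

Theorem theorem2p3 (R : realType) (N : nat)
  (f : 'cV[R]_N * 'cV[R]_N -> 'cV[R]_N) (tau : R)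
  (x : R -> 'cV[R]_N) (p : R) (Gamma : set 'M[R]_N) (h : 'M[R]_N)
  (U : R -> R -> Cseg (- tau) 0 'cV[R]_N -> Cseg (- tau) 0 'cV[R]_N)
  (F : R -> R[i] -> 'M[R[i]]_N) :
  Ck 2 f -> 0 < tau ->
  dde_solution f tau x -> minimal_period x p ->
  subgroup_GL Gamma -> compact Gamma -> equivariant Gamma f ->
  discrete_wave Gamma x p ->
  spatiotemporal_symmetries Gamma x p h -> Theta x p h * p = tau ->
  let A t := partial1 f (x t) (x (t - tau)) in
  let B t := partial2 f (x t) (x (t - tau)) in
  let toC := map_mx (real_complex R) in
  solution_operators A B U ->
  (forall z, fundamental_solution
     (fun t => toC (A t) + z *: (toC (B t) *m toC (invmx h))) (F ^~ z)) ->
  let Delta z := 1%:M - z *: (toC (invmx h) *m F (Theta x p h * p) z) in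
  let Uh phi := cact (invmx h) (U (Theta x p h * p) 0 phi) in
  characteristic_matrix_function (complexification Uh) Delta.
Proof.
move=> f2 tau0 xsol _ _ _ _ _ _ shiftE A B toC sU sF Delta Uh.
have cx : continuous x.
  by move=> t; apply/differentiable_continuous/derivable1_diffP; have [] := xsol t.
have cxd : continuous (fun t => x (t - tau)).
  move=> t; apply: (@continuous_comp _ _ _ (fun t => t - tau) x); last exact: cx.
  by apply: cvgB; [exact: cvg_id|exact: cvg_cst].
have [cA cB] := partials_continuous f2 cx cxd.
have [muA muA0 Amu] := continuous_mx_bounded (tau := tau) cA.
have [muB muB0 Bmu] := continuous_mx_bounded (tau := tau) cB.
rewrite /Delta /Uh shiftE.
(* The abstract [h] becomes [invmx h]; what remains is to represent the complexified operator by a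
   solution of the forced ODE on [[0, tau]]. *)
apply: (monodromy_characteristic_matrix tau0 Amu Bmu muA0 muB0 _ sF) => phi.
have [y1 [sy1 Uy1]] := sU 0 (cRe phi).
have [y2 [sy2 Uy2]] := sU 0 (cIm phi).
exists (fun t => map2_mx (@Complex R) (y1 t) (y2 t)); split.
- exact: dde_csol tau0 sy1 sy2.
- have [theta thE] : exists theta : set_type (`[- tau, 0]%classic : set R), \val theta = 0.
    by apply: seg_ex; rewrite lexx oppr_le0 ltW.
  have [/(_ theta) e1 _ _ _] := sy1; have [/(_ theta) e2 _ _ _] := sy2.
  rewrite (cext_val phi thE); rewrite thE addr0 in e1 e2; rewrite e1 e2.
  by apply/colP => i; rewrite !mxE; case: (phi theta i 0).
- move=> theta; rewrite (complexification_cact (invmx h) (U tau 0)).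
  congr (_ *m _); apply/colP => i; rewrite !mxE.
  by rewrite -Uy1 ?ltW// -Uy2 ?ltW.
Qed.
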